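(* Let $f\in C^1(\mathcal P_p)$ for some $p\in[1,\infty)\cup\{0\}$. Then there exist $C^1$ cylinder functions $f_n$, $n\in\mathbb N$, (with versions of their derivatives) such that $$f_n(\mu)\to f(\mu)\quad\text{and}\quad\frac{\partial f_n}{\partial\mu}(x,\mu)\to\frac{\partial f}{\partial\mu}(x,\mu)$$ for all $\mu\in\mathcal P_p$, $x\in\mathbb R^d$, and for every compact $K\subset\mathcal P_p$ there is a constant $c_K$ with $$|f_n(\mu)|\le c_K\quad\text{and}\quad\Big|\frac{\partial f_n}{\partial\mu}(x,\mu)\Big|\le c_K(1+|x|^p)$$ for all $\mu\in K$, $x\in\mathbb R^d$, $n\in\mathbb N$.
   Context: Fix $d\in\mathbb N$. $\mathcal P$ is the set of Borel probability measures on $\mathbb R^d$ (weak topology); for $p\in[1,\infty)$, $\mathcal P_p$ is the subset with finite $p$-th moment, with the Wasserstein-$p$ metric; $\mathcal P_0:=\mathcal P$; $|x|^0:=1$; $\mu(\varphi)=\int\varphi\,d\mu$. $C^1(\mathcal P_p)$ is the set of $f:\mathcal P_p\to\mathbb R$ for which there exists a continuous function $\frac{\partial f}{\partial\mu}:\mathbb R^d\times\mathcal P_p\to\mathbb R$ (a version of the derivative) such that for every compact $K\subset\mathcal P_p$ there is $c_K$ with $|\frac{\partial f}{\partial\mu}(x,\mu)|\le c_K(1+|x|^p)$ for all $x\in\mathbb R^d,\mu\in K$, and $f(\nu)-f(\mu)=\int_0^1\int_{\mathbb R^d}\frac{\partial f}{\partial\mu}(x,t\nu+(1-t)\mu)(\nu-\mu)(dx)\,dt$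 for all $\mu,\nu\in\mathcal P_p$. A $C^1$ cylinder function is $f(\mu)=\tilde f(\mu(\varphi_1),\dots,\mu(\varphi_n))$ with $n\in\mathbb N$, $\tilde f\in C^1(\mathbb R^n)$, $\varphi_i$ bounded continuous on $\mathbb R^d$; a version of its derivative is $\sum_i\partial_i\tilde f(\mu(\varphi_1),\dots,\mu(\varphi_n))\varphi_i(x)$. *)

(* Defs.v *)
From HB Require Import structures.
From mathcomp Require Import all_boot all_order all_algebra.
From mathcomp Require Import all_classical all_reals all_analysis.
Import Order.TTheory GRing.Theory Num.Theory.
Import numFieldNormedType.Exports.

Set Implicit Arguments.
Unset Strict Implicit.
Unset Printing Implicit Defensive.

Local Open Scope classical_set_scope.
Local Open Scope ring_scope.

(* R^d is represented by d.-tuple R with the product sigma-algebra of the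
   Borel sigma-algebras of R (= Borel sigma-algebra of R^d). *)
Definition Rd (R : realType) (d : nat) := d.-tuple R.

Section defs.
Variables (R : realType) (d : nat).

Local Notation Rd := (Rd R d).
Local Notation P := (probability Rd R).

Definition dist (x y : Rd) : R :=
  Num.sqrt (\sum_(i < d) (tnth x i - tnth y i) ^+ 2).
Definition enorm (x : Rd) : R := Num.sqrt (\sum_(i < d) (tnth x i) ^+ 2).

(* |x|^p, with the convention |x|^0 = 1 (powR 0 0 = 1) *)
Definition npow (p : R) (x : Rd) : R := enorm x `^ p.

Definition cont_Rd (g : Rd -> R) : Prop :=
  forall (x : Rd) (eps : R), 0 < eps ->
    exists2 del : R, 0 < del & forall y, dist y x < del -> `|g y - g x| < eps.

Definition bcont (g : Rd -> R) : Prop :=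
  cont_Rd g /\ exists M : R, forall x, `|g x| <= M.

Definition mint (mu : P) (g : Rd -> R) : R := Rintegral mu setT g.

(* P_p : finite p-th moment (for p = 0 this is all of P) *)
Definition Pp (p : R) : set P :=
  [set mu | (\int[mu]_x (npow p x)%:E < +oo)%E].

Definition coupling (mu nu : P) : set (probability (Rd * Rd)%type R) :=
  [set pi | forall A : set Rd, measurable A ->
      pi (A `*` setT) = mu A /\ pi (setT `*` A) = nu A].

Definition Wp (p : R) (mu nu : P) : R :=
  (fine (ereal_inf [set (\int[pi]_z ((dist z.1 z.2) `^ p)%:E)%E
                   | pi in coupling mu nu])) `^ (p^-1).

(* neighbourhoods of mu in P_p: weak topology for p = 0,
   W_p-metric topology for p >= 1 *)
Definition Pnbhd (p : R) (mu : P) (N : set P) : Prop :=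
  if p == 0 then
    exists (k : nat) (phi : 'I_k -> Rd -> R) (eps : R),
      [/\ forall i, bcont (phi i), 0 < eps &
        forall nu, Pp p nu ->
          (forall i, `|mint nu (phi i) - mint mu (phi i)| < eps) -> N nu]
  else
    exists2 eps : R, 0 < eps &
      forall nu, Pp p nu -> Wp p nu mu < eps -> N nu.

Definition Popen (p : R) (U : set P) : Prop :=
  U `<=` Pp p /\ forall mu, U mu -> Pnbhd p mu U.

Definition Pcompact (p : R) (K : set P) : Prop :=
  K `<=` Pp p /\
  forall (I : Type) (U : I -> set P), (forall i, Popen p (U i)) ->
    K `<=` \bigcup_i U i ->
    exists s : seq I, K `<=` \big[setU/set0]_(i <- s) U i.

Definition clamp01 (t : R) : R := Num.min 1 (Num.max 0 t).

Lemma clamp01_ge0 t : 0 <= clamp01 t.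
Proof.
rewrite /clamp01 le_min ler01 /= le_max lexx //.
Qed.

Lemma clamp01_le1 t : 0 <= 1 - clamp01 t.
Proof. by rewrite subr_ge0 /clamp01 ge_min lexx. Qed.

Definition pmix_fun (t : R) (nu mu : P) (A : set Rd) : \bar R :=
  measure_add (mscale (NngNum (clamp01_ge0 t)) nu)
              (mscale (NngNum (clamp01_le1 t)) mu) A.

Section pmix_inst.
Variables (t : R) (nu mu : P).
HB.instance Definition _ := Measure.copy (pmix_fun t nu mu)
  (measure_add (mscale (NngNum (clamp01_ge0 t)) nu)
               (mscale (NngNum (clamp01_le1 t)) mu)).
Lemma pmix_setT : pmix_fun t nu mu setT = 1%E.
Proof.
rewrite /pmix_fun measure_addE.
change ((clamp01 t)%:E * nu setT + (1 - clamp01 t)%:E * mu setT = 1)%E.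
rewrite !probability_setT -EFinD !mulr1.
by rewrite addrC subrK.
Qed.
HB.instance Definition _ :=
  Measure_isProbability.Build _ _ _ (pmix_fun t nu mu) pmix_setT.
End pmix_inst.

Definition pmix (t : R) (nu mu : P) : P := pmix_fun t nu mu.

Definition C1P (p : R) (f : P -> R) (Df : Rd -> P -> R) : Prop :=
  [/\
      (forall (x : Rd) (mu : P), Pp p mu -> forall eps : R, 0 < eps ->
         exists2 del : R, 0 < del & exists N, Pnbhd p mu N /\
           forall y nu, dist y x < del -> Pp p nu -> N nu ->
             `|Df y nu - Df x mu| < eps),
      (forall K, Pcompact p K -> exists c : R, forall x mu, K mu ->
         `|Df x mu| <= c * (1 + npow p x)) &
      (forall mu nu, Pp p mu -> Pp p nu ->
         ((f nu - f mu)%:E =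
          \int[lebesgue_measure]_(t in `[0%R, 1%R])
             (mint nu (Df ^~ (pmix t nu mu)) - mint mu (Df ^~ (pmix t nu mu)))%:E)%E)].

Definition pderiv (k : nat) (g : 'rV[R]_k -> R) (i : 'I_k) (y : 'rV[R]_k) : R :=
  'D_(delta_mx 0 i) g y.

Definition C1Rn (k : nat) (g : 'rV[R]_k -> R) : Prop :=
  forall i : 'I_k, (forall y, derivable g y (delta_mx 0 i)) /\
                   continuous (pderiv g i).

Definition cyl (k : nat) (g : 'rV[R]_k -> R) (phi : 'I_k -> Rd -> R) (mu : P) : R :=
  g (\row_i mint mu (phi i)).

Definition cylD (k : nat) (g : 'rV[R]_k -> R) (phi : 'I_k -> Rd -> R)
  (x : Rd) (mu : P) : R :=
  \sum_(i < k) pderiv g i (\row_j mint mu (phi j)) * phi i x.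

End defs.

(* Main.v *)
Require Import Defs.
From HB Require Import structures.
From mathcomp Require Import all_boot all_order all_algebra.
From mathcomp Require Import all_classical all_reals all_analysis.
From mathcomp Require Import measurable_realfun.
From mathcomp Require Import ring lra.
Import Order.TTheory GRing.Theory Num.Theory.
Import numFieldNormedType.Exports.

Set Implicit Arguments.
Unset Strict Implicit.
Unset Printing Implicit Defensive.

Local Open Scope classical_set_scope.
Local Open Scope ring_scope.

(* For a partition of unity [pou] subordinate to a finite net of nodes with mesh
   [1/(n+1)] on the ball of radius [n], let the discretization of [mu] be the
   measure [sum_i mu(pou_i) delta_(node i)].  Evaluated there, [f] and
   [Df (node i)] are functions of the vector [(mu(pou_i))_i] of the simplex, on
   which a Bernstein polynomial approximates [f] in C^1; composing it with that
   vector gives a cylinder function.  By the chain rule its derivative is close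
   to [sum_i pou_i(x) Df (node i)], which tends to [Df x mu] because the
   discretizations of [mu] tend to [mu].

   All topological arguments use neighbourhoods defined by integrals of finitely
   many continuous test functions of growth at most [1 + |x|^p].  They are the
   weak neighbourhoods for [p = 0] and the [W_p] neighbourhoods for [p > 0]: one
   inclusion integrates a pointwise estimate against an almost optimal coupling,
   the other one couples two measures cell by cell along the partition of unity.
   These neighbourhoods have a countable base, so [Df] is locally bounded by
   [c (1 + |x|^p)]: otherwise the bound would fail on a compact set made of a
   convergent sequence and its limit. *)

(** * Euclidean space *)

Lemma cauchy_schwarz_sum (R : realDomainType) (I : finType) (a b : I -> R) :
  (\sum_i a i * b i) ^+ 2 <= (\sum_i a i ^+ 2) * (\sum_i b i ^+ 2).
Proof.
set A := \sum_i a i ^+ 2; set B := \sum_i b i ^+ 2; set C := \sum_i a i * b i.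
have sq_ge0 (c : I -> R) : 0 <= \sum_i c i ^+ 2.
  by apply: sumr_ge0 => i _; exact: sqr_ge0.
have lagrange : B * (A * B - C ^+ 2) = \sum_i (B * a i - C * b i) ^+ 2.
  under eq_bigr => i _.
    rewrite (_ : _ ^+ 2 = B ^+ 2 * a i ^+ 2 - 2 * B * C * (a i * b i) +
      C ^+ 2 * b i ^+ 2); last by ring.
  over.
  by rewrite big_split sumrB/= -!mulr_sumr -/A -/B -/C; ring.
have [B0|B_neq0] := eqVneq B 0; last first.
  by rewrite -subr_ge0 -(pmulr_rge0 _ (_ : 0 < B)) ?lagrange// lt_def B_neq0 sq_ge0.
have b0 i : b i = 0.
  apply/eqP; rewrite -sqrf_eq0; apply/eqP.
  by apply: (psumr_eq0P _ B0) => // j _; exact: sqr_ge0.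
by rewrite B0 mulr0 /C big1 ?expr0n// => i _; rewrite b0 mulr0.
Qed.

Lemma minkowski_sum (R : rcfType) (I : finType) (a b : I -> R) :
  Num.sqrt (\sum_i (a i + b i) ^+ 2) <=
  Num.sqrt (\sum_i a i ^+ 2) + Num.sqrt (\sum_i b i ^+ 2).
Proof.
have sq_ge0 (c : I -> R) : 0 <= \sum_i c i ^+ 2.
  by apply: sumr_ge0 => i _; exact: sqr_ge0.
rewrite -ler_sqr ?nnegrE ?addr_ge0 ?sqrtr_ge0// sqrrD !sqr_sqrtr//.
under eq_bigr do rewrite sqrrD.
rewrite !big_split/= -mulr2n lerD2r lerD2l lerMn2r/=.
rewrite (le_trans (ler_norm _))// -ler_sqr ?nnegrE ?mulr_ge0 ?sqrtr_ge0//.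
by rewrite exprMn !sqr_sqrtr// real_normK ?num_real// cauchy_schwarz_sum.
Qed.

Lemma compact_unif_continuous (R : realFieldType) (X Y : pseudoMetricType R)
    (K : set X) (f : X -> Y) (e : R) :
  compact K -> {within K, continuous f} -> 0 < e ->
  \forall del \near 0^'+, forall x y, K x -> K y -> ball x del y ->
    ball (f x) e (f y).
Proof.
move=> /compact_near_coveringP/near_covering_withinP cK /subspace_continuousP cf e0.
pose P del x := forall y, K y -> ball x del y -> ball (f x) e (f y).
suff : \forall del \near 0^'+, K `<=` P del.
  by apply: filterS => del KP x y Kx Ky; exact: KP.
apply: cK => x Kx.
have e20 : 0 < e / 2 by rewrite divr_gt0.
have /nbhs_ballP[del /= del0 f_near_x] := cf x Kx _ (nbhsx_ballx _ _ e20).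
have del20 : 0 < del / 2 by rewrite divr_gt0.
exists (ball x (del / 2), [set t | t <= del / 2]) => /=.
  by split; [exact: nbhsx_ballx|exact: nbhs_right_le].
move=> [z t]/= [xz t_small] Kz y Ky zy.
apply: (ball_splitr (f_near_x z _ Kz)).
  by apply: le_ball xz; rewrite ler_pdivrMr// ler_pMr// ler1n.
apply: f_near_x Ky; apply: (ball_split xz).
by apply: le_ball zy.
Qed.

Lemma cvg_sum (K : numFieldType) (V : normedModType K) (T : Type)
    (F : set_system T) {FF : Filter F} (I : Type) (r : seq I)
    (f : I -> T -> V) (a : I -> V) :
  (forall i, f i @ F --> a i) ->
  \sum_(i <- r) f i t @[t --> F] --> \sum_(i <- r) a i.
Proof.
move=> fa; elim: r => [|i r ih].
  by under eq_fun do rewrite big_nil; rewrite big_nil; exact: cvg_cst.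
by under eq_fun do rewrite big_cons; rewrite big_cons; exact: cvgD (fa i) ih.
Qed.

Lemma near_invn_lt (R : archiRealFieldType) (e : R) : 0 < e ->
  \forall n \near \oo, n.+1%:R^-1 < e.
Proof. by move=> e0; exact: (near_infty_natSinv_lt (PosNum e0)). Qed.

Lemma near_mulr_invn_lt (R : archiRealFieldType) (A e : R) : 0 < e ->
  \forall n \near \oo, A * n.+1%:R^-1 < e.
Proof.
move=> e0; near=> n; apply: (@le_lt_trans _ _ ((`|A| + 1) * n.+1%:R^-1)).
  by rewrite ler_wpM2r// (le_trans (ler_norm A))// lerDl.
rewrite -ltr_pdivlMl ?ltr_wpDl// mulrC.
by near: n; apply: near_invn_lt; rewrite divr_gt0// ltr_wpDl.
Unshelve. all: by end_near. Qed.

Section euclidean_distance.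
Variables (R : realType) (d : nat).
Implicit Types x y z : Rd R d.

Lemma dist_ge0 x y : 0 <= dist x y. Proof. exact: sqrtr_ge0. Qed.

Lemma enorm_ge0 x : 0 <= enorm x. Proof. exact: sqrtr_ge0. Qed.

Lemma distC x y : dist x y = dist y x.
Proof. by congr Num.sqrt; apply: eq_bigr => i _; rewrite -sqrrN opprB. Qed.

Lemma distxx x : dist x x = 0.
Proof. by rewrite /dist big1 ?sqrtr0// => i _; rewrite subrr expr0n. Qed.

Lemma dist_triangle y x z : dist x z <= dist x y + dist y z.
Proof.
have := minkowski_sum (fun i => tnth x i - tnth y i) (fun i => tnth y i - tnth z i).
by under eq_bigr do rewrite addrA subrK.
Qed.

Lemma norm_tnthB_le_dist x y i : `|tnth x i - tnth y i| <= dist x y.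
Proof.
rewrite -sqrtr_sqr ler_wsqrtr// (bigD1 i)//= lerDl.
by apply: sumr_ge0 => j _; exact: sqr_ge0.
Qed.

Lemma dist_eq0 x y : dist x y = 0 -> x = y.
Proof.
move=> xy0; apply: eq_from_tnth => i; apply/eqP.
by rewrite -subr_eq0 -normr_le0 -xy0 norm_tnthB_le_dist.
Qed.

HB.instance Definition _ := Choice.copy (Rd R d) (d.-tuple R).
HB.instance Definition _ :=
  isMetric.Build R (Rd R d) distxx dist_eq0 distC dist_triangle.

End euclidean_distance.

Section euclidean_space.
Variables (R : realType) (d : nat).
Local Notation Rd := (Rd R d).
Implicit Types (x y z : Rd) (g h : Rd -> R).

Lemma ball_Rd x (e : R) : ball x e = [set y | dist x y < e].
Proof. exact: ballEmdist. Qed.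

Lemma nbhs_RdP x (A : set Rd) :
  nbhs x A <-> exists2 del : R, 0 < del & forall y, dist y x < del -> A y.
Proof.
split=> [/nbhs_ballP[del /= del0 xA]|[del del0 xA]].
  by exists del => // y yx; apply: xA; rewrite ball_Rd/= distC.
by apply/nbhs_ballP; exists del => //= y; rewrite ball_Rd/= distC; exact: xA.
Qed.

Lemma cont_RdP g : cont_Rd g <-> continuous g.
Proof.
split=> [cg x|cg x e e0].
  apply/(@cvgrPdist_lt _ _ _ (nbhs x)) => e /(cg x)[del del0 near_x].
  by apply/nbhs_RdP; exists del => // y /near_x; rewrite distrC.
have /(@cvgrPdist_lt _ _ _ (nbhs x))/(_ _ e0)/nbhs_RdP[del del0 near_x] := cg x.
by exists del => // y /near_x; rewrite distrC.
Qed.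

Lemma continuous_dist y : continuous (fun x : Rd => dist x y).
Proof.
apply/cont_RdP => x e e0; exists e => // z zx; rewrite ltr_norml.
have := dist_triangle x z y; have := dist_triangle z x y; rewrite (distC x z).
by move=> ? ?; apply/andP; split; lra.
Qed.

Definition zeroRd : Rd := [tuple 0 | i < d].

Lemma enormE x : enorm x = dist x zeroRd.
Proof. by congr Num.sqrt; apply: eq_bigr => i _; rewrite tnth_mktuple subr0. Qed.

Lemma enorm_zeroRd : enorm zeroRd = 0. Proof. by rewrite enormE distxx. Qed.

Lemma ler_enormD_dist x y : enorm x <= enorm y + dist x y.
Proof. by rewrite !enormE addrC dist_triangle. Qed.

Lemma dist_le_enormD x y : dist x y <= enorm x + enorm y.
Proof. by rewrite !enormE (distC y) dist_triangle. Qed.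

Lemma norm_tnth_le_enorm x i : `|tnth x i| <= enorm x.
Proof.
have := norm_tnthB_le_dist x zeroRd i.
by rewrite -enormE tnth_mktuple subr0.
Qed.

Lemma continuous_enorm : continuous (@enorm R d).
Proof.
have -> : @enorm R d = (fun x => dist x zeroRd) by apply/funext => x; exact: enormE.
exact: continuous_dist.
Qed.

Lemma dist_lt_tnth (e : R) x y : 0 < e ->
  (forall i, `|tnth x i - tnth y i| < e / d.+1%:R) -> dist x y < e.
Proof.
move=> e0 xy; rewrite -[ltRHS]ger0_norm ?(ltW e0)// -sqrtr_sqr.
rewrite ltr_sqrt ?exprn_gt0//.
apply: (@le_lt_trans _ _ (\sum_(i < d) (e ^+ 2 / d.+1%:R))).
  apply: ler_sum => i _; rewrite -[leLHS]real_normK ?num_real//.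
  apply: (@le_trans _ _ ((e / d.+1%:R) ^+ 2)).
    by rewrite ler_sqr ?nnegrE ?divr_ge0 ?(ltW e0)// ltW.
  rewrite exprMn ler_pM2l ?exprn_gt0// expr2 ler_piMl//.
  by rewrite invf_le1// ler1n.
rewrite sumr_const card_ord -mulrnAr gtr_pMr ?exprn_gt0//.
by rewrite -mulr_natl ltr_pdivrMr// mul1r ltr_nat.
Qed.

Lemma continuous_tuple_of_row :
  continuous ((fun v => [tuple v ord0 i | i < d]) : 'rV[R]_d -> Rd).
Proof.
move=> v A /nbhs_RdP[del del0 vA].
have deld0 : 0 < del / d.+1%:R by rewrite divr_gt0.
apply/nbhs_ballP; exists (del / d.+1%:R) => //= w vw; apply: vA.
apply: dist_lt_tnth => // i; rewrite !tnth_mktuple distrC.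
exact: (vw.2 ord0 i).
Qed.

Lemma compact_enorm_le (r : R) : compact [set x : Rd | enorm x <= r].
Proof.
have /= cbox := rV_compact (fun _ : 'I_d => @segment_compact R (- r) r).
apply: (subclosed_compact _ (continuous_compact
  (continuous_subspaceT continuous_tuple_of_row) cbox)).
  have := preimage_closed (f := @enorm R d) (D := [set t | t <= r]).
  by apply=> [x _|]; [exact: continuous_enorm|exact: closed_le].
move=> x xr; exists (\row_i tnth x i); last first.
  by apply: eq_from_tnth => i; rewrite tnth_mktuple mxE.
by move=> i; rewrite mxE /= in_itv/= -ler_norml (le_trans (norm_tnth_le_enorm x i)).
Qed.

Lemma unif_continuous_enorm_le g (r e : R) : continuous g -> 0 < e ->
  \forall del \near 0^'+, forall x y, enorm x <= r -> dist x y < del ->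
    `|g x - g y| < e.
Proof.
move=> cg e0.
have cg' := continuous_subspaceT (A := [set x | enorm x <= r + 1]) cg.
have unif := compact_unif_continuous (@compact_enorm_le (r + 1)) cg' e0.
near=> del => x y xr xy; apply: (near unif del) => //=.
  by rewrite (le_trans xr)// lerDl.
rewrite (le_trans (ler_enormD_dist y x))// lerD// distC.
by rewrite (le_trans (ltW xy))//; near: del; exact: nbhs_right_le.
Unshelve. all: by end_near. Qed.

Lemma dense_rat_tuple x (e : R) : 0 < e ->
  exists q : d.-tuple rat, dist x [tuple ratr (tnth q i) | i < d] < e.
Proof.
move=> e0; have ed0 : 0 < e / d.+1%:R by rewrite divr_gt0.
have /choice[q xq] i : exists q : rat, `|tnth x i - ratr q| < e / d.+1%:R.
  have /rat_in_itvoo[q] : tnth x i - e / d.+1%:R < tnth x i + e / d.+1%:R.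
    by rewrite ltrD2l gtrN.
  by rewrite in_itv/= => /andP[? ?]; exists q; rewrite distrC ltr_distl; apply/andP.
by exists [tuple q i | i < d]; apply: dist_lt_tnth => // i; rewrite !tnth_mktuple.
Qed.

Definition dense_seq (n : nat) : Rd :=
  if unpickle n is Some q then [tuple ratr (tnth (q : d.-tuple rat) i) | i < d]
  else zeroRd.

Lemma dense_seqP x (e : R) : 0 < e -> exists n, dist x (dense_seq n) < e.
Proof.
by move=> /(dense_rat_tuple x)[q xq]; exists (pickle q); rewrite /dense_seq pickleK.
Qed.

Lemma finite_net (r e : R) : 0 < e ->
  \forall k \near \oo, forall x, enorm x <= r ->
    exists2 i, (i < k)%N & dist x (dense_seq i) < e.
Proof.
move=> e0; have /compact_near_coveringP cr := @compact_enorm_le r.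
apply: (cr _ _ (fun k x => exists2 i, (i < k)%N & dist x (dense_seq i) < e) _).
move=> x _; have e20 : 0 < e / 2 by rewrite divr_gt0.
have [n xn] := dense_seqP x e20.
exists (ball x (e / 2), [set k | (n < k)%N]) => /=.
  by split; [exact: nbhsx_ballx|exact: nbhs_infty_gt].
move=> [y k] [/= xy nk]; exists n => //.
rewrite ball_Rd/= distC in xy.
by rewrite (le_lt_trans (dist_triangle x _ _))// [ltRHS]splitr ltrD.
Qed.

Lemma measurable_dist : measurable_fun setT (fun z : Rd * Rd => dist z.1 z.2).
Proof.
apply: (measurableT_comp (f := @Num.sqrt R)).
  exact: continuous_measurable_fun (@sqrt_continuous R).
apply: measurable_sum => i; apply: (measurable_funX 2) => //.
by apply: measurable_funB; apply: (measurableT_comp (measurable_tnth i)).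
Qed.

Lemma measurable_continuous_Rd g : continuous g -> measurable_fun setT g.
Proof.
move=> /cont_RdP cg; apply: (measurability _ (@RGenOInfty.measurableE R)) => //.
move=> _ [_ [c ->] <-]; rewrite setTI; set U := _ @^-1` _.
pose V (n : nat * nat) := [set y : Rd | dist (dense_seq n.1) y < n.2.+1%:R^-1].
have -> : U = \bigcup_(n in [set n | V n `<=` U]) V n.
  apply/seteqP; split=> [x Ux|x [n nU /nU//]].
  have [|del del0 near_x] := cg x (g x - c).
    by move: Ux; rewrite /U /= in_itv/= andbT subr_gt0.
  have xU y : dist y x < del -> U y.
    by move=> /near_x; rewrite /U /= in_itv/= andbT ltr_norml => /andP[]; lra.
  have del20 : 0 < del / 2 by rewrite divr_gt0.
  have [m _ /(_ m (leqnn m)) m_small] := near_invn_lt del20.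
  have [n xn] : exists n, dist x (dense_seq n) < m.+1%:R^-1 by exact: dense_seqP.
  exists (n, m); last by rewrite /V/= distC.
  move=> y /= yn; apply: xU; rewrite (le_lt_trans (dist_triangle (dense_seq n) _ _))//.
  by rewrite [ltRHS]splitr ltrD// ?(distC y) (lt_trans _ m_small)// distC.
rewrite bigcup_mkcond; apply: countable_bigcupT_measurable; first exact: countableP.
move=> n; case: ifP => // _; rewrite -[X in measurable X]setTI.
have := measurableT_comp measurable_dist (pair1_measurable (dense_seq n.1)).
by move=> /(_ measurableT _ (measurable_itv `]-oo, n.2.+1%:R^-1[)); rewrite set_itvNyo.
Qed.

End euclidean_space.

(** * Test functions of polynomial growth *)

Section powR.
Variables (R : realType) (p : R).

Lemma ler_powRD (a b : R) : 0 <= p -> 0 <= a -> 0 <= b ->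
  (a + b) `^ p <= 2 `^ p * (a `^ p + b `^ p).
Proof.
move=> p0; wlog ab : a b / a <= b => [sym|] a0 b0.
  have [ab|/ltW ba] := leP a b; first exact: sym.
  by rewrite addrC (addrC (a `^ _)); exact: sym.
apply: (@le_trans _ _ ((2 * b) `^ p)).
  apply: ge0_ler_powR; rewrite ?nnegrE ?addr_ge0 ?mulr_ge0//.
  by rewrite mulr_natl mulr2n lerD2r.
by rewrite powRM// ler_pM2l ?powR_gt0// lerDr powR_ge0.
Qed.

Lemma powR2_ge1 : 0 <= p -> 1 <= 2 `^ p :> R.
Proof. by move=> p0; rewrite -[leLHS](powRr0 2) ler_powR// ler1n. Qed.

Lemma continuous_norm_powR : 0 < p -> continuous (fun a : R => `|a| `^ p).
Proof.
move=> p0 a; have [->|a_neq0] := eqVneq a 0.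
  apply/cvgrPdist_lt => e e0; near=> b.
  rewrite normr0 powR0 ?gt_eqF// sub0r normrN ger0_norm ?powR_ge0//.
  have -> : e = (e `^ p^-1) `^ p by rewrite -powRrM mulVf ?gt_eqF// powRr1// ltW.
  apply: gt0_ltr_powR; rewrite ?nnegrE ?powR_ge0//.
  by near: b; apply: (@cvgr0_norm_lt _ _ _ (nbhs 0) _ id); rewrite ?powR_gt0.
have powR_at : {for `|a|, continuous (fun b : R => b `^ p)}.
  apply: differentiable_continuous; apply/derivable1_diffP.
  by apply: derivable_powR; rewrite in_itv/= normr_gt0 a_neq0.
exact: (continuous_comp (@norm_continuous _ _ a) powR_at).
Unshelve. all: by end_near. Qed.

End powR.

Lemma continuous_clamp01 (R : realType) : continuous (@clamp01 R).
Proof.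
move=> t; apply: (@continuous_min _ _ (cst 1)); first exact: cvg_cst.
by apply: (@continuous_max _ _ (cst 0)); [exact: cvg_cst|exact: cvg_id].
Qed.

Section test_functions.
Variables (R : realType) (d : nat) (p : R).
Hypothesis p0 : 0 <= p.
Local Notation Rd := (Rd R d).
Local Notation P := (probability Rd R).
Implicit Types (x y : Rd) (g h phi : Rd -> R) (mu nu : P).

Lemma npow_ge0 x : 0 <= npow p x. Proof. exact: powR_ge0. Qed.

Lemma continuous_npow : continuous (@npow R d p).
Proof.
move: p0; rewrite le_eqVlt => /predU1P[<-|p_gt0].
  have -> : @npow R d 0 = cst 1 by apply/funext => x; rewrite /npow powRr0.
  exact: cst_continuous.
have -> : @npow R d p = (fun a => `|a| `^ p) \o @enorm R d.
  by apply/funext => x; rewrite /= ger0_norm// enorm_ge0.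
move=> x; apply: (continuous_comp (@continuous_enorm _ _ x)).
exact: continuous_norm_powR.
Qed.

Definition weight x : R := 1 + npow p x.

Lemma weight_ge1 x : 1 <= weight x. Proof. by rewrite lerDl npow_ge0. Qed.

Lemma weight_gt0 x : 0 < weight x. Proof. exact: lt_le_trans (weight_ge1 x). Qed.

Lemma weight_ge0 x : 0 <= weight x. Proof. exact/ltW/weight_gt0. Qed.

Lemma weight_shift x y : enorm y <= enorm x + 1 -> weight y <= 2 * 2 `^ p * weight x.
Proof.
move=> yx; have two_p := powR2_ge1 p0.
rewrite -mulrA mulr_natl mulr2n lerD//; first by rewrite mulr_ege1// weight_ge1.
apply: (@le_trans _ _ ((enorm x + 1) `^ p)).
  by apply: ge0_ler_powR; rewrite ?nnegrE ?addr_ge0 ?enorm_ge0.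
by rewrite (le_trans (ler_powRD _ _ _)) ?enorm_ge0// powR1 addrC.
Qed.

Definition testfun phi :=
  continuous phi /\ exists C : R, forall x, `|phi x| <= C * weight x.

Lemma testfun_bound phi : testfun phi ->
  exists2 C : R, 0 < C & forall x, `|phi x| <= C * weight x.
Proof.
case=> _ [C phiC]; exists (`|C| + 1); first by rewrite ltr_wpDl.
move=> x; rewrite (le_trans (phiC x))// ler_wpM2r ?weight_ge0//.
by rewrite (le_trans (ler_norm _))// lerDl.
Qed.

Lemma testfun_weight : testfun weight.
Proof.
split; last by exists 1 => x; rewrite mul1r ger0_norm// weight_ge0.
by move=> x; apply: continuousD; [exact: cst_continuous|exact: continuous_npow].
Qed.

Lemma testfun_le g h : continuous g -> testfun h ->
  (forall x, `|g x| <= `|h x|) -> testfun g.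
Proof. by move=> cg [_ [C hC]] gh; split => //; exists C => x; rewrite (le_trans (gh x)). Qed.

Lemma testfun_npow : testfun (npow p).
Proof.
apply: testfun_le continuous_npow testfun_weight _ => x.
by rewrite !ger0_norm ?weight_ge0 ?npow_ge0// lerDr.
Qed.

Lemma testfun_cst (c : R) : testfun (fun=> c).
Proof.
split; first exact: cst_continuous.
by exists `|c| => x; rewrite ler_peMr// weight_ge1.
Qed.

Lemma testfunD g h : testfun g -> testfun h -> testfun (fun x => g x + h x).
Proof.
move=> [cg [C gC]] [ch [D hD]]; split.
  by move=> x; apply: continuousD; [exact: cg|exact: ch].
by exists (C + D) => x; rewrite (le_trans (ler_normD _ _))// mulrDl lerD.
Qed.

Lemma testfunZ (c : R) g : testfun g -> testfun (fun x => c * g x).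
Proof.
move=> [cg [C gC]]; split.
  by move=> x; apply: continuousM; [exact: cst_continuous|exact: cg].
by exists (`|c| * C) => x; rewrite normrM -mulrA ler_wpM2l.
Qed.

Lemma testfunB g h : testfun g -> testfun h -> testfun (fun x => g x - h x).
Proof.
move=> tg /(testfunZ (-1)) th; have := testfunD tg th.
by under [X in testfun X -> _]eq_fun do rewrite mulN1r.
Qed.

Lemma testfun_norm g : testfun g -> testfun (fun x => `|g x|).
Proof.
move=> [cg [C gC]]; split; last by exists C => x; rewrite normr_id.
by move=> x; apply: (continuous_comp (cg x)); exact: norm_continuous.
Qed.

Lemma testfun_sum (I : Type) (r : seq I) (G : I -> Rd -> R) :
  (forall i, testfun (G i)) -> testfun (fun x => \sum_(i <- r) G i x).
Proof.
move=> tG; elim: r => [|i r ih].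
  by under [X in testfun X]eq_fun do rewrite big_nil; exact: testfun_cst.
by under [X in testfun X]eq_fun do rewrite big_cons; exact: testfunD.
Qed.

Lemma bcont_testfun g : bcont g -> testfun g.
Proof.
move=> [/cont_RdP cg [M gM]]; apply: (testfun_le cg (testfun_cst M)) => x.
by rewrite (le_trans (gM x))// ler_norm.
Qed.

Lemma testfunM_bcont g h : testfun g -> bcont h -> testfun (fun x => g x * h x).
Proof.
move=> [cg [C gC]] [/cont_RdP ch [M hM]]; split.
  by move=> x; apply: continuousM; [exact: cg|exact: ch].
by exists (C * M) => x; rewrite normrM mulrAC ler_pM.
Qed.

Lemma measurable_testfun g : testfun g -> measurable_fun setT g.
Proof. by case=> cg _; exact: measurable_continuous_Rd. Qed.

Lemma testfun_integrable mu g : Pp p mu -> testfun g ->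
  mu.-integrable setT (EFin \o g).
Proof.
move=> mup tg; have [C _ gC] := testfun_bound tg.
have npow_integrable : mu.-integrable setT (EFin \o @npow R d p).
  apply/integrableP; split.
    by apply/measurable_EFinP; exact: measurable_continuous_Rd continuous_npow.
  by under eq_integral do rewrite gee0_abs ?lee_fin ?npow_ge0//.
have weight_integrable : mu.-integrable setT (EFin \o weight).
  apply: (@integrableD _ _ _ mu _ measurableT (cst 1%E) _ _ npow_integrable).
  exact: (finite_measure_integrable_cst mu 1 measurableT).
apply: (le_integrable measurableT _ _ (integrableZl measurableT C weight_integrable)).
  by apply/measurable_EFinP; exact: measurable_testfun.
by move=> x _ /=; rewrite lee_fin (le_trans (gC x))// ler_norm.
Qed.

End test_functions.

Section mint.
Variables (R : realType) (d : nat) (p : R).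
Hypothesis p0 : 0 <= p.
Local Notation Rd := (Rd R d).
Variable mu : probability Rd R.
Hypothesis mup : Pp p mu.
Implicit Types (x : Rd) (g h phi : Rd -> R).

Lemma mint_cst (c : R) : mint mu (fun=> c) = c.
Proof.
by transitivity (c * fine (mu setT)); [exact: Rintegral_cst|rewrite probability_setT mulr1].
Qed.

Lemma mint_ge0 g : (forall x, 0 <= g x) -> 0 <= mint mu g.
Proof. by move=> g0; apply: Rintegral_ge0 => x _. Qed.

Let integrable g : testfun p g -> mu.-integrable setT (EFin \o g).
Proof. exact: testfun_integrable. Qed.

Lemma mintE g : testfun p g -> (mint mu g)%:E = (\int[mu]_x (g x)%:E)%E.
Proof. by move=> tg; rewrite fineK//; apply: integrable_fin_num => //; exact: integrable. Qed.

Lemma mintD g h : testfun p g -> testfun p h ->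
  mint mu (fun x => g x + h x) = mint mu g + mint mu h.
Proof. by move=> tg th; rewrite /mint RintegralD//; exact: integrable. Qed.

Lemma mintB g h : testfun p g -> testfun p h ->
  mint mu (fun x => g x - h x) = mint mu g - mint mu h.
Proof. by move=> tg th; rewrite /mint RintegralB//; exact: integrable. Qed.

Lemma mintZ (c : R) g : testfun p g -> mint mu (fun x => c * g x) = c * mint mu g.
Proof. by move=> tg; rewrite /mint RintegralZl//; exact: integrable. Qed.

Lemma mint_sum (I : Type) (r : seq I) (G : I -> Rd -> R) : (forall i, testfun p (G i)) ->
  mint mu (fun x => \sum_(i <- r) G i x) = \sum_(i <- r) mint mu (G i).
Proof.
move=> tG; elim: r => [|i r ih].
  by under eq_fun do rewrite big_nil; rewrite mint_cst big_nil.
under eq_fun do rewrite big_cons.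
by rewrite mintD ?ih ?big_cons//; exact: testfun_sum.
Qed.

Lemma mint_le g h : testfun p g -> testfun p h ->
  (forall x, g x <= h x) -> mint mu g <= mint mu h.
Proof. by move=> tg th gh; rewrite /mint le_Rintegral//; exact: integrable. Qed.

Lemma norm_mint_le g h : testfun p g -> testfun p h ->
  (forall x, `|g x| <= h x) -> `|mint mu g| <= mint mu h.
Proof.
move=> tg th gh; apply: (@le_trans _ _ (mint mu (fun x => `|g x|))).
  by rewrite /mint le_normr_Rintegral//; exact: integrable.
by apply: mint_le => //; exact: testfun_norm.
Qed.

End mint.

Section tail.
Variables (R : realType) (d : nat) (p : R).
Hypothesis p0 : 0 <= p.
Local Notation Rd := (Rd R d).
Local Notation P := (probability Rd R).
Implicit Types (x : Rd) (phi : Rd -> R) (mu nu : P).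

Definition tail (r : R) x : R := weight p x * clamp01 (enorm x - r).

Lemma tail_ge0 r x : 0 <= tail r x.
Proof. by rewrite mulr_ge0 ?clamp01_ge0 ?weight_ge0. Qed.

Lemma tail_le_weight r x : tail r x <= weight p x.
Proof. by rewrite ler_piMr ?weight_ge0// -subr_ge0 clamp01_le1. Qed.

Lemma tail_eq0 r x : enorm x <= r -> tail r x = 0.
Proof. by move=> xr; rewrite /tail /clamp01 max_l ?subr_le0// min_r ?mulr0. Qed.

Lemma tail_eq_weight r x : r + 1 <= enorm x -> tail r x = weight p x.
Proof.
move=> xr; rewrite /tail /clamp01 min_l ?mulr1// le_max; apply/orP; right.
by rewrite lerBrDl.
Qed.

Lemma testfun_tail r : testfun p (tail r).
Proof.
apply: testfun_le (testfun_weight _ p0) _; last first.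
  by move=> x; rewrite !ger0_norm ?tail_le_weight ?tail_ge0 ?weight_ge0.
move=> x; apply: continuousM; first exact: (testfun_weight d p0).1.
apply: (@continuous_comp _ _ _ (fun x => enorm x - r) (@clamp01 R)).
  by apply: continuousB; [exact: continuous_enorm|exact: cst_continuous].
exact: continuous_clamp01.
Qed.

Lemma mint_tail_cvg0 mu : Pp p mu -> mint mu (tail n%:R) @[n --> \oo] --> (0 : R).
Proof.
move=> mup; have := @dominated_convergence _ _ _ mu setT measurableT
  (fun n x => (tail n%:R x)%:E) (fun=> 0%E) (EFin \o @weight R d p).
case=> //.
- by move=> n; apply/measurable_EFinP; exact: measurable_testfun (testfun_tail _).
- apply: aeW => x _; apply: cvg_near_cst; near=> n.
  by rewrite tail_eq0//; near: n; exact: nbhs_infty_ger.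
- exact: testfun_integrable (testfun_weight _ _).
- by apply: aeW => x n _; rewrite lee_fin ger0_norm ?tail_ge0 ?tail_le_weight.
by move=> _ _; rewrite integral0 => /fine_cvgP[_].
Unshelve. all: by end_near. Qed.

Lemma norm_mintB_le_tail mu phi psi (e C r : R) : Pp p mu ->
  testfun p phi -> testfun p psi ->
  (forall x, `|phi x - psi x| <= e + C * tail r x) ->
  `|mint mu phi - mint mu psi| <= e + C * mint mu (tail r).
Proof.
move=> mup tphi tpsi close; have tCtail := testfunZ C (testfun_tail r).
rewrite -(mintB p0)// -[e](mint_cst mu) -(mintZ p0)//; last exact: testfun_tail.
rewrite -(mintD p0)//; last exact: testfun_cst.
by apply: (norm_mint_le p0); [|exact: testfunB|exact/testfunD/tCtail/testfun_cst|].
Qed.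

(* Convergence uniform on bounded sets, dominated by the weight: this is what
   lets the limit be exchanged with [mint mu] locally uniformly in [mu]. *)
Definition dominated_cvg (I : Type) (F : set_system I) (phi_ : I -> Rd -> R) phi :=
  (forall e r : R, 0 < e ->
     \forall i \near F, forall x, enorm x <= r -> `|phi_ i x - phi x| <= e) /\
  exists C : R, \forall i \near F, forall x, `|phi_ i x - phi x| <= C * weight p x.

Lemma dominated_cvg_tail (I : Type) (F : set_system I) {FF : Filter F}
    (phi_ : I -> Rd -> R) phi :
  dominated_cvg F phi_ phi -> exists2 C : R, 0 < C &
    forall e r : R, 0 < e ->
      \forall i \near F, forall x, `|phi_ i x - phi x| <= e + C * tail r x.
Proof.
move=> [unif [C domC]]; exists (`|C| + 1); first by rewrite ltr_wpDl.
move=> e r e0; near=> i => x.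
have Ctail_ge0 : 0 <= (`|C| + 1) * tail r x by rewrite mulr_ge0 ?addr_ge0 ?tail_ge0.
have [xr|/ltW xr] := leP (enorm x) (r + 1).
  rewrite (@le_trans _ _ e) ?lerDl//; move: x xr {Ctail_ge0}.
  by near: i; exact: unif.
rewrite tail_eq_weight// (@le_trans _ _ (C * weight p x))//.
  by move: x {xr Ctail_ge0}; near: i; exact: domC.
rewrite -[leLHS]add0r lerD ?(ltW e0)// ler_wpM2r ?weight_ge0//.
by rewrite (le_trans (ler_norm _))// lerDl.
Unshelve. all: by end_near. Qed.

End tail.

(** * The topology of P_p through test functions *)

Section test_topology.
Variables (R : realType) (d : nat) (p : R).
Hypothesis p0 : 0 <= p.
Local Notation Rd := (Rd R d).
Local Notation P := (probability Rd R).
Implicit Types (x : Rd) (phi : Rd -> R) (mu nu : P).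

Definition tnbhs mu : set_system P :=
  [set N | exists (k : nat) (phi : 'I_k -> Rd -> R) (e : R),
  [/\ forall i, testfun p (phi i), 0 < e &
    forall nu, Pp p nu -> (forall i, `|mint nu (phi i) - mint mu (phi i)| < e) -> N nu]].

Global Instance tnbhs_filter mu : Filter (tnbhs mu).
Proof.
split.
- by exists 0%N, (fun=> cst 0), 1; split => // i; exact: testfun_cst.
- move=> A B [k [phi [e [tphi e0 phiA]]]] [l [psi [e' [tpsi e'0 psiB]]]].
  exists (k + l)%N, (fun i => match fintype.split i with inl j => phi j | inr j => psi j end).
  exists (Num.min e e'); split; [by move=> i; case: fintype.split|by rewrite lt_min e0|].
  move=> nu nup close; split.
    apply: phiA => // i; have := close (unsplit (inl i)).
    by rewrite unsplitK lt_min => /andP[].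
  apply: psiB => // i; have := close (unsplit (inr i)).
  by rewrite unsplitK lt_min => /andP[].
- move=> A B AB [k [phi [e [tphi e0 phiA]]]]; exists k, phi, e; split => // nu nup close.
  by apply: AB; exact: phiA.
Qed.

Lemma near_tnbhs_Pp mu : \forall nu \near tnbhs mu, Pp p nu.
Proof. by exists 0%N, (fun=> cst 0), 1; split => // i; exact: testfun_cst. Qed.

Lemma tnbhs_singleton mu (N : set P) : Pp p mu -> tnbhs mu N -> N mu.
Proof. by move=> mup [k [phi [e [_ e0]]]]; apply => // i; rewrite subrr normr0. Qed.

Lemma tnbhs_interior mu (N : set P) : tnbhs mu N ->
  \forall nu \near tnbhs mu, tnbhs nu N.
Proof.
move=> [k [phi [e [tphi e0 phiN]]]].
have e20 : 0 < e / 2 by rewrite divr_gt0.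
exists k, phi, (e / 2); split => // nu _ close; exists k, phi, (e / 2); split => //.
move=> nu' nup close'; apply: phiN => // i.
by rewrite (le_lt_trans (ler_distD (mint nu (phi i)) _ _))// [ltRHS]splitr ltrD.
Qed.

Lemma mint_tnbhs_cvg mu phi : testfun p phi ->
  mint nu phi @[nu --> tnbhs mu] --> mint mu phi.
Proof.
move=> tphi; apply/cvgrPdist_lt => e e0.
by exists 1%N, (fun=> phi), e; split => // nu _ /(_ ord0); rewrite distrC.
Qed.

Lemma cvg_tnbhsP (I : Type) (F : set_system I) {FF : Filter F} (nu : I -> P) mu :
  nu @ F --> tnbhs mu <-> (\forall i \near F, Pp p (nu i)) /\
    forall phi, testfun p phi -> mint (nu i) phi @[i --> F] --> mint mu phi.
Proof.
split=> [nu_mu|[nup nu_mu] N [k [phi [e [tphi e0 phiN]]]]].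
  split=> [|phi tphi]; first by apply: nu_mu; exact: near_tnbhs_Pp.
  exact: (cvg_comp nu (fun nu => mint nu phi) nu_mu (mint_tnbhs_cvg tphi)).
have close : \forall i \near F, forall j, `|mint (nu i) (phi j) - mint mu (phi j)| < e.
  apply: filter_forall => j; have /cvgrPdist_lt/(_ _ e0) := nu_mu _ (tphi j).
  by apply: filterS => i; rewrite distrC.
by near=> i; apply: phiN; near: i.
Unshelve. all: by end_near. Qed.

Lemma near_mint_tail_lt mu (e : R) : Pp p mu -> 0 < e ->
  exists r : nat, \forall nu \near tnbhs mu, mint nu (tail p r%:R) < e.
Proof.
move=> mup e0; have /cvgrPdist_lt/(_ _ e0)[r _ /(_ r (leqnn r))] := mint_tail_cvg0 p0 mup.
rewrite sub0r normrN => /(le_lt_trans (ler_norm _)) small; exists r.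
by apply: (cvgr_lt _ (mint_tnbhs_cvg (testfun_tail _ p0 r%:R))).
Qed.

Lemma dominated_cvg_mint (I : Type) (F : set_system I) {FF : Filter F}
    (phi_ : I -> Rd -> R) phi mu :
  Pp p mu -> testfun p phi -> (\forall i \near F, testfun p (phi_ i)) ->
  dominated_cvg p F phi_ phi ->
  mint z.1 (phi_ z.2) @[z --> filter_prod (tnbhs mu) F] --> mint mu phi.
Proof.
move=> mup tphi tphi_ /dominated_cvg_tail[C C0 close].
apply/cvgrPdist_lt => e e0.
have e30 : 0 < e / 3 by rewrite divr_gt0.
have [r tail_small] := near_mint_tail_lt mup (divr_gt0 e30 C0).
have /cvgrPdist_lt/(_ _ e30) mint_close := mint_tnbhs_cvg (mu := mu) tphi.
near=> z; rewrite (le_lt_trans (ler_distD (mint z.1 phi) _ _))//.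
have z1_close : `|mint mu phi - mint z.1 phi| < e / 3.
  by near: z; exact: cvg_fst mint_close.
have z1_tail : mint z.1 (tail p r%:R) < e / 3 / C by near: z; exact: cvg_fst tail_small.
have z2_close : `|mint z.1 (phi_ z.2) - mint z.1 phi| <=
    e / 3 + C * mint z.1 (tail p r%:R).
  apply: norm_mintB_le_tail => //.
  - by near: z; apply: cvg_fst; exact: near_tnbhs_Pp.
  - by near: z; exact: cvg_snd tphi_.
  - by near: z; exact: cvg_snd (close _ r%:R e30).
rewrite distrC in z2_close.
have : C * mint z.1 (tail p r%:R) < e / 3 by rewrite mulrC -ltr_pdivlMr.
by lra.
Unshelve. all: by end_near. Qed.

End test_topology.

(** * Mixtures and finitely supported measures *)

Section integral_comparison.
Context d (T : measurableType d) (R : realType) (mu : {measure set T -> \bar R}).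
Implicit Types f g : T -> \bar R.
Local Open Scope ereal_scope.

(* No measurability is needed: the integral of a nonnegative function is a
   supremum over the simple functions below it. *)
Lemma ge0_le_integral_pointwise f g : (forall x, 0 <= f x) ->
  (forall x, f x <= g x) -> \int[mu]_x f x <= \int[mu]_x g x.
Proof.
move=> f0 fg; rewrite !ge0_integralTE// => [|x]; last exact: le_trans (fg x).
apply: ge_ereal_sup => _ [h /= hf <-]; apply: ereal_sup_ubound.
by exists h => // x; exact: le_trans (fg x).
Qed.

Lemma le_integral_pointwise (D : set T) f g : (forall x, D x -> f x <= g x) ->
  \int[mu]_(x in D) f x <= \int[mu]_(x in D) g x.
Proof.
move=> fg; have fgD x : (f \_ D) x <= (g \_ D) x.
  by rewrite !patchE; case: ifPn => // /set_mem; exact: fg.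
rewrite integral_mkcond [leRHS]integral_mkcond integralE [leRHS]integralE.
apply: leeB; apply: ge0_le_integral_pointwise => // x.
- by rewrite !funeposE ge_max !le_max fgD lexx orbT.
- by rewrite !funenegE ge_max !le_max leeN2 fgD lexx orbT.
Qed.

End integral_comparison.

Lemma unit_integral_dist_le (R : realType) (r a M : R) (f : R -> R) :
  (r%:E = \int[lebesgue_measure]_(t in `[0%R, 1%R]) (f t)%:E)%E ->
  (forall t, 0 <= t <= 1 -> `|f t - a| <= M) -> `|r - a| <= M.
Proof.
move=> rE fM; pose I01 := `[0%R, 1%R]%classic : set R.
have int_cst (c : R) : (\int[lebesgue_measure]_(t in I01) (cst c%:E) t = c%:E)%E.
  rewrite integral_cst//; last exact: measurable_itv.
  by rewrite /= lebesgue_measure_itv/= lte01 sube0 mule1.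
rewrite ler_distl -!lee_fin rE -(int_cst (a - M)) -(int_cst (a + M)).
apply/andP; split; apply: le_integral_pointwise => t; rewrite /I01/= in_itv/= => /fM;
  by rewrite ler_distl lee_fin => /andP[].
Qed.

Lemma mnormalize_eq d (T : measurableType d) (R : realType)
    (mu : {measure set T -> \bar R}) (P : probability T R) :
  mu setT = 1%E -> mnormalize mu P = mu :> (set T -> \bar R).
Proof.
move=> mu1; apply/funext => A.
by rewrite /mnormalize mu1 onee_eq0/= invr1 mule1.
Qed.

Lemma Rintegral_combination d (T : measurableType d) (R : realType) (I : finType)
    (kappa : {measure set T -> \bar R}) (m : I -> {measure set T -> \bar R})
    (c : I -> R) (f : T -> R) :
  (forall g : T -> \bar R, measurable_fun setT g -> (forall x, 0 <= g x)%E ->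
    (\int[kappa]_x g x = \sum_i (c i)%:E * \int[m i]_x g x)%E) ->
  measurable_fun setT f -> (forall i, (m i).-integrable setT (EFin \o f)) ->
  \int[kappa]_x f x = \sum_i c i * \int[m i]_x f x.
Proof.
move=> kappaE mf intf; have mEf : measurable_fun setT (EFin \o f) by exact/measurable_EFinP.
pose pos i := fine (\int[m i]_x (EFin \o f)^\+ x)%E.
pose neg i := fine (\int[m i]_x (EFin \o f)^\- x)%E.
have posE i : (\int[m i]_x (EFin \o f)^\+ x = (pos i)%:E)%E.
  by rewrite fineK//; exact: integrable_pos_fin_num.
have negE i : (\int[m i]_x (EFin \o f)^\- x = (neg i)%:E)%E.
  by rewrite fineK//; exact: integrable_neg_fin_num.
rewrite /Rintegral integralE !kappaE//; last 2 first.
- exact: measurable_funeneg.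
- exact: measurable_funepos.
under eq_bigr do rewrite posE -EFinM; under [X in (_ - X)%E]eq_bigr do rewrite negE -EFinM.
rewrite !sumEFin -EFinB/= -sumrB; apply: eq_bigr => i _.
by rewrite integralE posE negE -EFinB/= mulrBr.
Qed.

Definition scaled_simplex (R : numDomainType) (k : nat) (s : R) : set 'rV[R]_k :=
  [set y | (forall i, 0 <= y 0 i) /\ \sum_i y 0 i = s].

Notation simplex := (scaled_simplex 1).

Section finitely_supported.
Context d (T : measurableType d) (R : realType) (k : nat).
Implicit Types (x : 'I_k.+1 -> T) (y : 'rV[R]_k.+1).

Definition weighted_diracs x y : {measure set T -> \bar R} :=
  msum (fun i : nat => mscale (NngNum (normr_ge0 (y 0 (inord i)))) \d_(x (inord i))) k.+1.

(* The normalization is only there to get a probability measure for all [y]. *)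
Definition discrete_measure x y : probability T R :=
  mnormalize (weighted_diracs x y) \d_(x 0).

Lemma ge0_integral_discrete_measure x y (f : T -> \bar R) : simplex y ->
  measurable_fun setT f -> (forall z, 0 <= f z)%E ->
  (\int[discrete_measure x y]_z f z = \sum_i (y 0 i)%:E * \int[\d_(x i)]_z f z)%E.
Proof.
move=> [y0 y1] mf f0.
have mass1 : weighted_diracs x y setT = 1%E.
  rewrite -[RHS]/(1%:E) -y1 -sumEFin; apply: eq_bigr => i _.
  by rewrite inord_val /= /mscale/= diracT mule1 ger0_norm.
transitivity (\int[weighted_diracs x y]_z f z)%E.
  by apply: eq_measure_integral => A _ _; rewrite /discrete_measure/= mnormalize_eq.
rewrite ge0_integral_measure_sum//; apply: eq_bigr => i _.
by rewrite ge0_integral_mscale//= inord_val ger0_norm.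
Qed.

End finitely_supported.

Section mixtures.
Variables (R : realType) (d : nat) (p : R).
Hypothesis p0 : 0 <= p.
Local Notation Rd := (Rd R d).
Local Notation P := (probability Rd R).
Implicit Types (x : Rd) (phi : Rd -> R) (mu nu : P).

Lemma mint_pmix (t : R) mu nu : 0 <= t <= 1 -> Pp p mu -> Pp p nu ->
  Pp p (pmix t nu mu) /\ forall phi, testfun p phi ->
    mint (pmix t nu mu) phi = t * mint nu phi + (1 - t) * mint mu phi.
Proof.
move=> /andP[t0 t1] mup nup.
have clampE : clamp01 t = t by rewrite /clamp01 max_r// min_r.
pose m (b : bool) := if b then nu else mu.
pose c (b : bool) := if b then t else 1 - t.
have pmixE (g : Rd -> \bar R) : measurable_fun setT g -> (forall x, 0 <= g x)%E ->
    (\int[pmix t nu mu]_x g x = \sum_b (c b)%:E * \int[m b]_x g x)%E.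
  move=> mg g0; rewrite big_bool/=.
  transitivity (\int[measure_add (mscale (NngNum (clamp01_ge0 t)) nu)
      (mscale (NngNum (clamp01_le1 t)) mu)]_x g x)%E; first by apply: eq_measure_integral.
  by rewrite ge0_integral_measure_add// !ge0_integral_mscale//= clampE.
have mnpow : measurable_fun setT (EFin \o @npow R d p).
  by apply/measurable_EFinP; exact: measurable_continuous_Rd (continuous_npow p0).
split=> [|phi tphi].
  rewrite /Pp/= pmixE//; last by move=> x; rewrite lee_fin npow_ge0.
  by rewrite big_bool/= lte_add_pinfty// lte_mul_pinfty// lee_fin ?subr_ge0.
rewrite /mint (Rintegral_combination pmixE) ?big_bool//; first exact: measurable_testfun tphi.
by case; exact: testfun_integrable tphi.
Qed.

Lemma Pp_dirac x : Pp p (\d_x : P).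
Proof.
rewrite /Pp/= integral_dirac//= ?diracT ?mul1e ?ltry//.
by apply/measurable_EFinP; exact: measurable_continuous_Rd (continuous_npow p0).
Qed.

Lemma mint_dirac x phi : continuous phi -> mint (\d_x : P) phi = phi x.
Proof.
move=> cphi; rewrite /mint /Rintegral integral_dirac//=; first by rewrite indicE in_setT mul1r.
by apply/measurable_EFinP; exact: measurable_continuous_Rd.
Qed.

Lemma mint_discrete_measure k (x : 'I_k.+1 -> Rd) (y : 'rV[R]_k.+1) : simplex y ->
  Pp p (discrete_measure x y) /\ forall phi, testfun p phi ->
    mint (discrete_measure x y) phi = \sum_i y 0 i * phi (x i).
Proof.
move=> sy; have integralE := ge0_integral_discrete_measure x sy.
split=> [|phi tphi].
  rewrite /Pp/= integralE//; last by move=> z; rewrite lee_fin npow_ge0.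
    by apply: lte_sum_pinfty => i _; rewrite lte_mul_pinfty ?lee_fin ?sy.1//; exact: Pp_dirac.
  by apply/measurable_EFinP; exact: measurable_continuous_Rd (continuous_npow p0).
rewrite /mint (Rintegral_combination integralE); last 2 first.
- exact: measurable_testfun tphi.
- by move=> i; apply: testfun_integrable tphi => //; exact: Pp_dirac.
by apply: eq_bigr => i _; rewrite -[X in _ * X]/(mint _ phi) mint_dirac//; exact: tphi.1.
Qed.

Lemma pmix_tnbhs mu (N : set P) : Pp p mu -> tnbhs p mu N ->
  \forall nu \near tnbhs p mu, forall t : R, 0 <= t <= 1 -> N (pmix t nu mu).
Proof.
move=> mup [k [phi [e [tphi e0 phiN]]]]; exists k, phi, e; split => // nu nup close t t01.
have [mixp mixE] := mint_pmix t01 mup nup; apply: phiN => // i; rewrite mixE//.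
have -> : t * mint nu (phi i) + (1 - t) * mint mu (phi i) - mint mu (phi i) =
  t * (mint nu (phi i) - mint mu (phi i)) by ring.
move: t01 => /andP[t0 t1].
by rewrite normrM (ger0_norm t0) (le_lt_trans _ (close i))// ler_piMl.
Qed.

End mixtures.

(** * Discretization along a partition of unity *)

Lemma ltn_neq_ord_max k (i : 'I_k.+1) : i != ord_max -> (i < k)%N.
Proof. by move=> i_max; rewrite ltn_neqAle -ltnS ltn_ord andbT. Qed.

Section partition_of_unity.
Variables (R : realType) (d : nat).
Local Notation Rd := (Rd R d).
Implicit Types (x : Rd) (e : R).

Definition bump e (i : nat) x : R := clamp01 (2 - dist x (dense_seq R d i) / e).

Lemma bump_ge0 e i x : 0 <= bump e i x. Proof. exact: clamp01_ge0. Qed.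

Lemma bump_compl_ge0 e i x : 0 <= 1 - bump e i x. Proof. exact: clamp01_le1. Qed.

Lemma bump_eq1 e i x : 0 < e -> dist x (dense_seq R d i) <= e -> bump e i x = 1.
Proof.
move=> e0 xi; rewrite /bump /clamp01 min_l// le_max; apply/orP; right.
have : dist x (dense_seq R d i) / e <= 1 by rewrite ler_pdivrMr// mul1r.
by lra.
Qed.

Lemma bump_neq0 e i x : 0 < e -> bump e i x != 0 -> dist x (dense_seq R d i) < 2 * e.
Proof.
move=> e0; rewrite ltNge; apply: contra; rewrite -ler_pdivlMr// => xi.
by rewrite /bump /clamp01 max_l ?min_r// subr_le0.
Qed.

Lemma continuous_bump e i : continuous (bump e i).
Proof.
move=> x; apply: (@continuous_comp _ _ _ (fun x => 2 - dist x (dense_seq R d i) / e)).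
  apply: continuousB; first exact: cst_continuous.
  by apply: continuousM; [exact: continuous_dist|exact: cst_continuous].
exact: continuous_clamp01.
Qed.

Fixpoint bump_rest e (k : nat) x : R :=
  if k is k'.+1 then bump_rest e k' x * (1 - bump e k' x) else 1.

Lemma bump_rest_ge0 e k x : 0 <= bump_rest e k x.
Proof. by elim: k => //= k ih; rewrite mulr_ge0// bump_compl_ge0. Qed.

Lemma continuous_bump_rest e k : continuous (bump_rest e k).
Proof.
elim: k => [|k ih]; first exact: cst_continuous.
have -> : bump_rest e k.+1 = (fun x => bump_rest e k x * (1 - bump e k x)) by [].
move=> x; apply: continuousM; first exact: ih.
by apply: continuousB; [exact: cst_continuous|exact: continuous_bump].
Qed.

Lemma bump_rest_eq0 e k i x : 0 < e -> (i < k)%N -> dist x (dense_seq R d i) < e ->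
  bump_rest e k x = 0.
Proof.
move=> e0 + xi; elim: k => //= k ih.
rewrite ltnS leq_eqVlt => /predU1P[<-|/ih ->]; last by rewrite mul0r.
by rewrite bump_eq1 ?ltW// subrr mulr0.
Qed.

(* The complements [bump_rest] telescope, so no division is needed to get a sum
   of 1; the last function is the part of the space that the net misses. *)
Definition pou_of e (k i : nat) x : R :=
  if (i < k)%N then bump e i x * bump_rest e i x else bump_rest e k x.

Lemma sum_pou_of e k x : \sum_(i < k.+1) pou_of e k i x = 1.
Proof.
rewrite big_ord_recr/= {2}/pou_of ltnn; under eq_bigr do rewrite /pou_of ltn_ord.
elim: k => [|k ih]; first by rewrite big_ord0 add0r.
by rewrite big_ord_recr/= -[RHS]ih; ring.
Qed.

Definition mesh (n : nat) : R := (2 * n.+1%:R)^-1.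

Lemma mesh_gt0 n : 0 < mesh n. Proof. by rewrite invr_gt0 mulr_gt0. Qed.

Lemma net_exists n : exists k, forall x, enorm x <= n%:R ->
  exists2 i, (i < k)%N & dist x (dense_seq R d i) < mesh n.
Proof.
by have [k _ /(_ k (leqnn k)) net] := @finite_net R d n%:R _ (mesh_gt0 n); exists k.
Qed.

Definition net_size n : nat := sval (cid (net_exists n)).

Definition pou n (i : 'I_(net_size n).+1) x : R := pou_of (mesh n) (net_size n) i x.

Definition node n (i : 'I_(net_size n).+1) : Rd :=
  if (i < net_size n)%N then dense_seq R d i else zeroRd R d.

Lemma pou_ge0 n i x : 0 <= @pou n i x.
Proof.
by rewrite /pou /pou_of; case: ifP => _; rewrite ?mulr_ge0 ?bump_ge0 ?bump_rest_ge0.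
Qed.

Lemma sum_pou n x : \sum_i @pou n i x = 1. Proof. exact: sum_pou_of. Qed.

Lemma pou_le1 n i x : @pou n i x <= 1.
Proof.
by rewrite -(sum_pou n x) (bigD1 i)//= lerDl sumr_ge0// => j _; exact: pou_ge0.
Qed.

Lemma bcont_pou n i : bcont (@pou n i).
Proof.
split; last by exists 1 => x; rewrite ger0_norm ?pou_ge0 ?pou_le1.
apply/cont_RdP; rewrite /pou /pou_of; case: (i < net_size n)%N => x.
  by apply: continuousM; [exact: continuous_bump|exact: continuous_bump_rest].
exact: continuous_bump_rest.
Qed.

Lemma dist_node_lt n (i : 'I_(net_size n).+1) x : i != ord_max -> pou i x != 0 ->
  dist x (node i) < n.+1%:R^-1.
Proof.
move=> /ltn_neq_ord_max; rewrite /pou /pou_of /node => ->.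
rewrite mulf_eq0 negb_or => /andP[/bump_neq0 xi _].
by rewrite (lt_le_trans (xi (mesh_gt0 n)))// /mesh invfM mulrA divff// mul1r.
Qed.

Lemma pou_ord_max_far n x : @pou n ord_max x != 0 -> n%:R < enorm x.
Proof.
rewrite /pou /pou_of ltnn ltNge; apply: contra => xn.
have [i ik xi] := svalP (cid (net_exists n)) x xn.
by rewrite (bump_rest_eq0 (mesh_gt0 n) ik xi).
Qed.

Lemma dist_node_lt_of_enorm n i x : @pou n i x != 0 -> enorm x <= n%:R ->
  dist x (node i) < n.+1%:R^-1.
Proof.
have [->|i_max] := eqVneq i ord_max; last by move=> /(dist_node_lt i_max).
by move=> /pou_ord_max_far; rewrite ltNge => /negbTE ->.
Qed.

Lemma enorm_node_le n i x : @pou n i x != 0 -> enorm (node i) <= enorm x + 1.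
Proof.
have [->|i_max xi] := eqVneq i ord_max.
  by rewrite /node ltnn enorm_zeroRd addr_ge0// enorm_ge0.
rewrite (le_trans (ler_enormD_dist _ x))// lerD2l distC ltW//.
by rewrite (lt_le_trans (dist_node_lt i_max xi))// invf_le1// ler1n.
Qed.

Lemma pou_mean_dist_le n (v : 'I_(net_size n).+1 -> R) x (a D : R) :
  (forall i, pou i x != 0 -> `|v i - a| <= D) -> `|\sum_i pou i x * v i - a| <= D.
Proof.
move=> close; have -> : \sum_i pou i x * v i - a = \sum_i pou i x * (v i - a).
  by under [RHS]eq_bigr do rewrite mulrBr; rewrite sumrB -mulr_suml sum_pou mul1r.
rewrite (le_trans (ler_norm_sum _ _ _))//.
rewrite -[leRHS]mul1r -(sum_pou n x) mulr_suml; apply: ler_sum => i _.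
rewrite normrM ger0_norm ?pou_ge0//.
have [->|/close xi] := eqVneq (pou i x) 0; first by rewrite !mul0r.
by rewrite ler_wpM2l// pou_ge0.
Qed.

Definition interp n (phi : Rd -> R) x : R := \sum_i @pou n i x * phi (node i).

Lemma interp_cvg (phi_ : nat -> Rd -> R) x (a : R) :
  phi_ z.1 z.2 @[z --> filter_prod \oo (nbhs x)] --> a ->
  interp n (phi_ n) x @[n --> \oo] --> a.
Proof.
move=> phi_a; apply/cvgrPdist_le => e e0.
have /cvgrPdist_le/(_ _ e0)[[N V] /= [N_oo /nbhs_RdP[del del0 xV]] NV] := phi_a.
near=> n; rewrite distrC; apply: pou_mean_dist_le => i xi; rewrite distrC.
apply: (NV (n, node i)); split => /=; first by near: n.
apply: xV; rewrite distC (lt_trans (dist_node_lt_of_enorm xi _))//.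
  by near: n; exact: nbhs_infty_ger.
by near: n; exact: near_invn_lt.
Unshelve. all: by end_near. Qed.

Lemma interp_unif_cvg (phi : Rd -> R) (e r : R) : continuous phi -> 0 < e ->
  \forall n \near \oo, forall x, enorm x <= r -> `|interp n phi x - phi x| <= e.
Proof.
move=> cphi e0; have unif := unif_continuous_enorm_le r cphi e0.
have [del [close del0]] := filter_ex (filterI unif (nbhs_right_gt 0)).
near=> n => x xr; apply: pou_mean_dist_le => i xi; rewrite distrC ltW// close//.
rewrite (lt_trans (dist_node_lt_of_enorm xi _))//.
  by rewrite (le_trans xr)//; near: n; exact: nbhs_infty_ger.
by near: n; exact: near_invn_lt.
Unshelve. all: by end_near. Qed.

End partition_of_unity.

Arguments net_size {R d}.
Arguments pou {R d n}.
Arguments node {R d n}.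

Section discretization.
Variables (R : realType) (d : nat) (p : R).
Hypothesis p0 : 0 <= p.
Local Notation Rd := (Rd R d).
Local Notation P := (probability Rd R).
Local Notation net_size := (@net_size R d).
Implicit Types (x : Rd) (phi : Rd -> R) (mu nu : P).

Lemma testfun_pou n (i : 'I_(net_size n).+1) : testfun p (pou i).
Proof. exact: bcont_testfun (bcont_pou i). Qed.

Lemma interp_growth n phi (C : R) x : (forall y, `|phi y| <= C * weight p y) ->
  `|interp n phi x| <= C * (2 * 2 `^ p) * weight p x.
Proof.
move=> phiC; rewrite -[interp n phi x]subr0; apply: pou_mean_dist_le => i xi.
rewrite subr0 (le_trans (phiC _))// -mulrA ler_wpM2l//; last first.
  exact: weight_shift (enorm_node_le xi).
by rewrite -(pmulr_lge0 _ (weight_gt0 p x)) (le_trans _ (phiC x)).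
Qed.

Lemma testfun_interp n phi : testfun p (interp n phi).
Proof.
apply: testfun_sum => i; under [X in testfun _ X]eq_fun do rewrite mulrC.
exact: testfunZ (testfun_pou i).
Qed.

Lemma dominated_cvg_interp phi : testfun p phi ->
  dominated_cvg p \oo (fun n => interp n phi) phi.
Proof.
move=> tphi; split=> [e r|]; first exact: interp_unif_cvg tphi.1.
have [C C0 phiC] := testfun_bound tphi.
exists (C * (2 * 2 `^ p) + C); apply: nearW => n x.
by rewrite (le_trans (ler_normB _ _))// mulrDl lerD// interp_growth.
Qed.

Lemma mint_interp n mu phi : Pp p mu ->
  mint mu (interp n phi) = \sum_i mint mu (@pou R d n i) * phi (node i).
Proof.
move=> mup; rewrite (mint_sum p0)//; last first.
  move=> i; under [X in testfun _ X]eq_fun do rewrite mulrC.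
  exact: testfunZ (testfun_pou i).
apply: eq_bigr => i _; under eq_fun do rewrite mulrC.
by rewrite (mintZ p0) 1?mulrC//; exact: testfun_pou.
Qed.

Definition cell_masses n mu : 'rV[R]_(net_size n).+1 := \row_i mint mu (pou i).

Lemma simplex_cell_masses n mu : Pp p mu -> simplex (cell_masses n mu).
Proof.
move=> mup; split=> [i|]; first by rewrite mxE mint_ge0// => x; exact: pou_ge0.
under eq_bigr do rewrite mxE.
rewrite -(mint_sum p0)//; last exact: testfun_pou.
by under eq_fun do rewrite sum_pou; rewrite mint_cst.
Qed.

Definition discretization n mu : P := discrete_measure node (cell_masses n mu).

Lemma Pp_discretization n mu : Pp p mu -> Pp p (discretization n mu).
Proof. by move=> mup; have [] := mint_discrete_measure p0 node (simplex_cell_masses n mup). Qed.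

Lemma mint_discretization n mu phi : Pp p mu -> testfun p phi ->
  mint (discretization n mu) phi = mint mu (interp n phi).
Proof.
move=> mup tphi.
have [_ ->//] := mint_discrete_measure p0 node (simplex_cell_masses n mup).
by rewrite mint_interp//; apply: eq_bigr => i _; rewrite mxE.
Qed.

Lemma discretization_cvg mu : Pp p mu ->
  discretization z.2 z.1 @[z --> filter_prod (tnbhs p mu) \oo] --> tnbhs p mu.
Proof.
move=> mup; apply/cvg_tnbhsP.
have near_Pp : \forall z \near filter_prod (tnbhs p mu) (\oo : set_system nat), Pp p z.1.
  exact: cvg_fst (near_tnbhs_Pp _ _).
split=> [|phi tphi]; first by apply: filterS near_Pp => z; exact: Pp_discretization.
apply: cvg_trans (dominated_cvg_mint p0 mup tphi _ (dominated_cvg_interp tphi)).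
  apply: near_eq_cvg; apply: filterS near_Pp => z zp.
  by rewrite mint_discretization.
by apply: nearW => n; exact: testfun_interp.
Qed.

Lemma discretization_cvg_at mu : Pp p mu ->
  discretization n mu @[n --> \oo] --> tnbhs p mu.
Proof.
move=> mup N /(discretization_cvg mup)[[A B] /= [muA Boo] AB].
by apply: filterS Boo => n Bn; apply: (AB (mu, n)); split => //; exact: tnbhs_singleton muA.
Qed.

Lemma tnbhs_countably_determined (I : Type) (F : set_system I) {FF : Filter F}
    (nu : I -> P) mu :
  Pp p mu -> (\forall i \near F, Pp p (nu i)) ->
  (forall n (j : 'I_(net_size n).+1),
     mint (nu i) (pou j) @[i --> F] --> mint mu (pou j)) ->
  (forall r : nat, mint (nu i) (tail p r%:R) @[i --> F] --> mint mu (tail p r%:R)) ->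
  nu @ F --> tnbhs p mu.
Proof.
move=> mup nup pou_cvg tail_cvg; apply/cvg_tnbhsP; split => // phi tphi.
have [C C0 close] := dominated_cvg_tail (dominated_cvg_interp tphi).
apply/cvgrPdist_lt => e e0; have e50 : 0 < e / 5 by rewrite divr_gt0.
have eC0 : 0 < e / 5 / C by rewrite divr_gt0.
have [r mu_nbhs_tail] := near_mint_tail_lt p0 mup eC0.
have mu_tail := tnbhs_singleton mup mu_nbhs_tail.
have [n _ /(_ n (leqnn n)) interp_close] := close _ r%:R e50.
have interp_nu : mint (nu i) (interp n phi) @[i --> F] --> mint mu (interp n phi).
  rewrite mint_interp//.
  apply: (@cvg_trans _ ((fun i => \sum_j mint (nu i) (@pou R d n j) * phi (node j)) @ F)).
    by apply: near_eq_cvg; apply: filterS nup => i nuip; rewrite mint_interp.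
  by apply: cvg_sum => j; exact: cvgM (pou_cvg n j) (cvg_cst _).
have mint_interp_close m : Pp p m ->
    `|mint m (interp n phi) - mint m phi| <= e / 5 + C * mint m (tail p r%:R).
  by move=> mp; apply: norm_mintB_le_tail => //; exact: testfun_interp.
near=> i; have nuip : Pp p (nu i) by near: i.
have nu_tail : mint (nu i) (tail p r%:R) < e / 5 / C.
  by near: i; exact: cvgr_lt (tail_cvg r) _ mu_tail.
have interp_nu_close : `|mint mu (interp n phi) - mint (nu i) (interp n phi)| < e / 5.
  by near: i; exact: cvgr_dist_lt interp_nu _ e50.
have := mint_interp_close _ mup; have := mint_interp_close _ nuip.
have scale (t : R) : t < e / 5 / C -> C * t < e / 5 by rewrite ltr_pdivlMr// mulrC.
have := scale _ mu_tail; have := scale _ nu_tail.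
move: interp_nu_close; rewrite !ltr_norml !ler_norml => /andP[? ?] ? ? /andP[? ?] /andP[? ?].
by apply/andP; split; lra.
Unshelve. all: by end_near. Qed.

Definition cell_nbhs mu (j : nat) : set P := [set nu | Pp p nu /\ forall n : 'I_j.+1,
  (forall i : 'I_(net_size n).+1, `|mint mu (pou i) - mint nu (pou i)| < j.+1%:R^-1) /\
  `|mint mu (tail p (n : nat)%:R) - mint nu (tail p (n : nat)%:R)| < j.+1%:R^-1].

Lemma near_cell_nbhs mu j : tnbhs p mu (cell_nbhs mu j).
Proof.
have j0 : 0 < j.+1%:R^-1 :> R by [].
have close phi : testfun p phi ->
    \forall nu \near tnbhs p mu, `|mint mu phi - mint nu phi| < j.+1%:R^-1.
  by move=> tphi; have /cvgrPdist_lt/(_ _ j0) := mint_tnbhs_cvg (mu := mu) tphi.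
have pou_close : \forall nu \near tnbhs p mu, forall (n : 'I_j.+1) (i : 'I_(net_size n).+1),
    `|mint mu (pou i) - mint nu (pou i)| < j.+1%:R^-1.
  by do 2![apply: filter_forall => ?]; exact/close/testfun_pou.
have tail_close : \forall nu \near tnbhs p mu, forall n : 'I_j.+1,
    `|mint mu (tail p (n : nat)%:R) - mint nu (tail p (n : nat)%:R)| < j.+1%:R^-1.
  by apply: filter_forall => ?; exact/close/testfun_tail.
near=> nu; split=> [|n]; first by near: nu; exact: near_tnbhs_Pp.
by split; [move: n; near: nu; exact: pou_close|move: n; near: nu; exact: tail_close].
Unshelve. all: by end_near. Qed.

Lemma cell_nbhs_cvg mu (nu : nat -> P) : Pp p mu -> (forall j, cell_nbhs mu j (nu j)) ->
  nu @ \oo --> tnbhs p mu.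
Proof.
move=> mup nu_cell; apply: tnbhs_countably_determined => //.
- by apply: nearW => j; exact: (nu_cell j).1.
- move=> n i; apply/cvgrPdist_lt => e e0; near=> j.
  have nj : (n < j.+1)%N by near: j; exact: nbhs_infty_ge.
  apply: lt_trans (((nu_cell j).2 (Ordinal nj)).1 i) _.
  by near: j; exact: near_invn_lt.
- move=> r; apply/cvgrPdist_lt => e e0; near=> j.
  have rj : (r < j.+1)%N by near: j; exact: nbhs_infty_ge.
  apply: lt_trans ((nu_cell j).2 (Ordinal rj)).2 _.
  by near: j; exact: near_invn_lt.
Unshelve. all: by end_near. Qed.

End discretization.

(** * Coupling two measures along a partition of unity *)

Section nonneg_real_integral.
Context d (T : measurableType d) (R : realType) (m : {measure set T -> \bar R}).
Implicit Types F G : T -> R.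

Lemma ge0_integralZl_real F (b : R) : measurable_fun setT F -> (forall x, 0 <= F x) ->
  0 <= b -> (\int[m]_x (b * F x)%:E = b%:E * \int[m]_x (F x)%:E)%E.
Proof.
move=> mF F0 b0; under eq_integral do rewrite EFinM.
by apply: ge0_integralZl_EFin => //; [move=> x _; rewrite lee_fin|exact/measurable_EFinP].
Qed.

Lemma ge0_integralD_real F G : measurable_fun setT F -> (forall x, 0 <= F x) ->
  measurable_fun setT G -> (forall x, 0 <= G x) ->
  (\int[m]_x (F x + G x)%:E = \int[m]_x (F x)%:E + \int[m]_x (G x)%:E)%E.
Proof.
move=> mF F0 mG G0; under eq_integral do rewrite EFinD.
by apply: ge0_integralD => //; (try exact/measurable_EFinP) => x _; rewrite lee_fin.
Qed.

Lemma ge0_integral_sum_real (I : Type) (r : seq I) (F : I -> T -> R) :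
  (forall i, measurable_fun setT (F i)) -> (forall i x, 0 <= F i x) ->
  (\int[m]_x (\sum_(i <- r) F i x)%:E = \sum_(i <- r) \int[m]_x (F i x)%:E)%E.
Proof.
move=> mF F0; under eq_integral do rewrite -sumEFin.
apply: ge0_integral_sum => //; first by move=> i; exact/measurable_EFinP.
by move=> i x _; rewrite lee_fin.
Qed.

End nonneg_real_integral.

Section density.
Context d (T : measurableType d) (R : realType) (m : {measure set T -> \bar R}).
Variables (w : T -> R) (mw : measurable_fun setT w) (w0 : forall x, 0 <= w x).

Definition mdensity (_ : measurable_fun setT w) (_ : forall x, 0 <= w x) (A : set T) :=
  (\int[m]_(x in A) (w x)%:E)%E.

Let mEw : measurable_fun setT (EFin \o w).
Proof. exact/measurable_EFinP. Qed.

Let mdensity0 : mdensity mw w0 set0 = 0%E.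
Proof. by rewrite /mdensity integral_set0. Qed.

Let mdensity_ge0 A : (0 <= mdensity mw w0 A)%E.
Proof. by apply: integral_ge0 => x _; rewrite lee_fin. Qed.

Let mdensity_sigma_additive : semi_sigma_additive (mdensity mw w0).
Proof.
move=> F mF tF mUF; rewrite /mdensity ge0_integral_bigcup//.
- apply: is_cvg_ereal_nneg_natsum_cond => n _ _; exact: mdensity_ge0.
- exact: measurable_funTS.
- by move=> x _; rewrite lee_fin.
Qed.

HB.instance Definition _ := isMeasure.Build _ _ _ (mdensity mw w0)
  mdensity0 mdensity_ge0 mdensity_sigma_additive.

Import HBNNSimple.

Lemma integral_mdensity_nnsfun (h : {nnsfun T >-> R}) :
  (\int[mdensity mw w0]_x (h x)%:E = \int[m]_x (h x * w x)%:E)%E.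
Proof.
rewrite integralT_nnsfun sintegralE.
have hw x : (h x * w x)%:E =
    (\sum_(r \in range h) (r * (w x * \1_(h @^-1` [set r]) x))%:E)%E.
  rewrite fsumEFin//; congr EFin; rewrite [in LHS](fimfunE h) mulr_fsuml.
  by apply: eq_fsbigr => r _; rewrite [w x * _]mulrC mulrA.
have mwi r : measurable_fun setT (fun x => w x * \1_(h @^-1` [set r]) x).
  by apply: measurable_funM => //; exact: measurable_indic.
under [RHS]eq_integral do rewrite hw.
rewrite ge0_integral_fsum//; last 2 first.
- by move=> r; apply/measurable_EFinP; apply: measurable_funM.
- move=> r x _; rewrite lee_fin indicE.
  case: (boolP (x \in _)) => [|_]; last by rewrite !mulr0.
  by rewrite inE/= => <-; rewrite mulr_ge0// mulr_ge0.
apply: eq_fsbigr => r /set_mem[x _ <-]; rewrite ge0_integralZl_real//; last first.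
  by move=> y; rewrite mulr_ge0.
congr (_ * _)%E; rewrite /= /mdensity integral_mkcond; apply: eq_integral => y _.
by rewrite patchE indicE; case: ifP => _ /=; rewrite ?mulr1 ?mulr0.
Qed.

Lemma ge0_integral_mdensity (g : T -> R) : measurable_fun setT g ->
  (forall x, 0 <= g x) ->
  (\int[mdensity mw w0]_x (g x)%:E = \int[m]_x (g x * w x)%:E)%E.
Proof.
move=> mg g0; have mEg : measurable_fun setT (EFin \o g) by exact/measurable_EFinP.
have Eg0 x : setT x -> (0 <= (EFin \o g) x)%E by rewrite lee_fin.
pose h := nnsfun_approx measurableT mEg.
have h_cvg x : (h n x)%:E @[n --> \oo] --> (g x)%:E by exact: cvg_nnsfun_approx.
have h_mono x : {homo (fun n => h n x) : a b / (a <= b)%N >-> a <= b}.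
  by move=> a b ab; exact/lefP/nd_nnsfun_approx.
transitivity (lim (\int[mdensity mw w0]_x (h n x)%:E @[n --> \oo])%E).
  rewrite -monotone_convergence//.
  - by apply: eq_integral => x _; apply/esym/cvg_lim.
  - by move=> n; apply/measurable_EFinP.
  - by move=> n x _; rewrite lee_fin.
  - by move=> x _ a b ab; rewrite lee_fin h_mono.
under eq_fun do rewrite integral_mdensity_nnsfun.
rewrite -monotone_convergence//.
- apply: eq_integral => x _; apply/cvg_lim => //; under eq_fun do rewrite EFinM.
  by rewrite EFinM; apply: cvgeZr.
- by move=> n; apply/measurable_EFinP; exact: measurable_funM.
- by move=> n x _; rewrite lee_fin mulr_ge0.
- by move=> x _ a b ab; rewrite lee_fin ler_wpM2r ?h_mono.
Qed.

End density.

Lemma ge0_integral_product d1 d2 (T1 : measurableType d1) (T2 : measurableType d2)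
    (R : realType) (m1 : {sigma_finite_measure set T1 -> \bar R})
    (m2 : {sigma_finite_measure set T2 -> \bar R}) (u : T1 -> R) (v : T2 -> R) :
  measurable_fun setT u -> (forall x, 0 <= u x) ->
  measurable_fun setT v -> (forall y, 0 <= v y) ->
  (\int[m1 \x m2]_z (u z.1 * v z.2)%:E =
   \int[m1]_x (u x)%:E * \int[m2]_y (v y)%:E)%E.
Proof.
move=> mu u0 mv v0; have mEu : measurable_fun setT (EFin \o u) by exact/measurable_EFinP.
rewrite fubini_tonelli1/=; last 2 first.
- apply/measurable_EFinP; apply: measurable_funM.
  + exact: measurableT_comp mu measurable_fst.
  + exact: measurableT_comp mv measurable_snd.
- by move=> z; rewrite lee_fin mulr_ge0.
rewrite /fubini_F/=; under eq_integral do rewrite ge0_integralZl_real//.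
rewrite ge0_integralZr//; first by move=> x _; rewrite lee_fin.
by apply: integral_ge0 => x _; rewrite lee_fin.
Qed.

(* With [o i = min (a i) (b i)], moving the common mass [o i] within the cell
   [i] and the rest by the product plan has the right first marginal.  Null
   cells are harmless since division by zero gives 0. *)
Lemma overlap_marginal (R : realFieldType) (k : nat) (a b al : 'I_k -> R) :
  (forall i, 0 <= al i <= a i) -> (forall i, 0 <= b i) -> \sum_i a i = 1 ->
  let o i := Num.min (a i) (b i) in let s := 1 - \sum_i o i in
  \sum_i o i / (a i * b i) * (al i * b i) + (\sum_i (1 - o i / a i) * al i) * (s / s) =
  \sum_i al i.
Proof.
move=> alP b0 a1 o s; have a0 i : 0 <= a i by have /andP[/le_trans] := alP i; apply.
have al_eq0 i : a i = 0 -> al i = 0.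
  by move=> ai0; apply/eqP; rewrite eq_le; have := alP i; rewrite ai0 andbC.
have o_le i : o i <= a i by rewrite ge_min lexx.
have [s0|s_neq0] := eqVneq s 0.
  have oE i : o i = a i.
    apply/eqP; rewrite eq_sym -subr_eq0; apply/eqP.
    apply: (psumr_eq0P (P := xpredT) (F := fun i => a i - o i)) => //.
      by move=> j _; rewrite subr_ge0.
    by rewrite sumrB a1.
  rewrite s0 invr0 !mulr0 addr0; apply: eq_bigr => i _; rewrite oE.
  have [ai0|ai_neq0] := eqVneq (a i) 0; first by rewrite al_eq0// mul0r !mulr0.
  have bi_neq0 : b i != 0.
    apply: contra ai_neq0 => /eqP bi0.
    by rewrite eq_le a0 andbT -(oE i) /o bi0 ge_min lexx orbT.
  by field; rewrite ai_neq0 bi_neq0.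
rewrite divff// mulr1 -big_split/=; apply: eq_bigr => i _.
have [ai0|ai_neq0] := eqVneq (a i) 0; first by rewrite al_eq0// mul0r !mulr0 addr0.
have [bi0|bi_neq0] := eqVneq (b i) 0.
  have -> : o i = 0 by rewrite /o bi0 min_r.
  by rewrite !mul0r subr0 mul1r add0r.
by field; rewrite ai_neq0 bi_neq0.
Qed.

Section overlap_coupling.
Context d (T : measurableType d) (R : realType) (k : nat) (psi : 'I_k -> T -> R).
Hypothesis mpsi : forall i, measurable_fun setT (psi i).
Hypothesis psi_ge0 : forall i x, 0 <= psi i x.
Hypothesis sum_psi : forall x, \sum_i psi i x = 1.
Local Notation P := (probability T R).
Implicit Types (m nu mu : P) (i : 'I_k).

Let psi_le1 i x : psi i x <= 1.
Proof. by rewrite -(sum_psi x) (bigD1 i)//= lerDl sumr_ge0. Qed.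

Definition cell_mass m i : R := \int[m]_x psi i x.

Definition overlap nu mu i : R := Num.min (cell_mass nu i) (cell_mass mu i).

Definition deficit nu mu : R := 1 - \sum_i overlap nu mu i.

Definition residual nu mu (x : T) : R :=
  \sum_i (1 - overlap nu mu i / cell_mass nu i) * psi i x.

Definition overlap_density nu mu (z : T * T) : R :=
  \sum_i overlap nu mu i / (cell_mass nu i * cell_mass mu i) * (psi i z.1 * psi i z.2) +
  (deficit nu mu)^-1 * (residual nu mu z.1 * residual mu nu z.2).

Definition cell_mass_in m (A : set T) i : R := \int[m]_x (\1_A x * psi i x).

Let measurable_cell_in (A : set T) i : measurable A ->
  measurable_fun setT (fun x => \1_A x * psi i x).
Proof. by move=> mA; apply: measurable_funM => //; exact: measurable_indic. Qed.

Let cell_in_ge0 (A : set T) i x : 0 <= \1_A x * psi i x.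
Proof. by rewrite mulr_ge0. Qed.

Let cell_in_le (A : set T) i x : \1_A x * psi i x <= psi i x.
Proof. by rewrite ler_piMl// indicE; case: (_ \in _). Qed.

Lemma cell_mass_inE m (A : set T) i :
  (\int[m]_x (\1_A x * psi i x)%:E = (cell_mass_in m A i)%:E)%E.
Proof.
rewrite fineK// ge0_fin_numE; last by apply: integral_ge0 => x _; rewrite lee_fin.
apply: (@le_lt_trans _ _ (\int[m]_x (cst 1%E) x)%E); last first.
  by rewrite integral_cst// mul1e /= probability_setT ltry.
apply: ge0_le_integral_pointwise => x; rewrite lee_fin//.
by rewrite (le_trans (cell_in_le A i x)).
Qed.

Lemma cell_mass_setT m i : cell_mass_in m setT i = cell_mass m i.
Proof. by congr fine; apply: eq_integral => x _; rewrite indicT mul1r. Qed.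

Lemma cell_massE m i : (\int[m]_x (psi i x)%:E = (cell_mass m i)%:E)%E.
Proof.
rewrite -cell_mass_setT -cell_mass_inE.
by apply: eq_integral => x _; rewrite indicT mul1r.
Qed.

Lemma cell_mass_in_bounds m (A : set T) i : 0 <= cell_mass_in m A i <= cell_mass m i.
Proof.
rewrite -!lee_fin -cell_mass_inE -cell_massE integral_ge0/=; last first.
  by move=> x _; rewrite lee_fin.
by apply: ge0_le_integral_pointwise => x; rewrite lee_fin.
Qed.

Lemma cell_mass_ge0 m i : 0 <= cell_mass m i.
Proof. by apply: Rintegral_ge0 => x _. Qed.

Lemma sum_cell_integral m (u : T -> R) : measurable_fun setT u -> (forall x, 0 <= u x) ->
  (\sum_i \int[m]_x (u x * psi i x)%:E = \int[m]_x (u x)%:E)%E.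
Proof.
move=> mu u0; rewrite -ge0_integral_sum_real.
- by apply: eq_integral => x _; rewrite -mulr_sumr sum_psi mulr1.
- by move=> i; exact: measurable_funM.
- by move=> i x; rewrite mulr_ge0.
Qed.

Lemma sum_cell_mass m : \sum_i cell_mass m i = 1.
Proof.
apply: EFin_inj; rewrite -sumEFin.
transitivity (\int[m]_x (cst 1 x)%:E)%E; last first.
  by rewrite (integral_cst _ _ 1%E)// mul1e /= probability_setT.
rewrite -sum_cell_integral//; apply: eq_bigr => i _; rewrite -cell_massE.
by apply: eq_integral => x _; rewrite /= mul1r.
Qed.

Lemma overlap_ge0 nu mu i : 0 <= overlap nu mu i.
Proof. by rewrite le_min !cell_mass_ge0. Qed.

Lemma overlapC nu mu i : overlap nu mu i = overlap mu nu i.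
Proof. exact: minC. Qed.

Lemma deficitC nu mu : deficit nu mu = deficit mu nu.
Proof. by congr (1 - _); apply: eq_bigr => i _; exact: overlapC. Qed.

Lemma sum_overlap_le1 nu mu : \sum_i overlap nu mu i <= 1.
Proof. by rewrite -(sum_cell_mass nu) ler_sum// => i _; rewrite ge_min lexx. Qed.

Lemma deficit_ge0 nu mu : 0 <= deficit nu mu.
Proof. by rewrite subr_ge0 sum_overlap_le1. Qed.

Lemma residual_coef_ge0 nu mu i : 0 <= 1 - overlap nu mu i / cell_mass nu i.
Proof.
have [->|nui_neq0] := eqVneq (cell_mass nu i) 0; first by rewrite invr0 mulr0 subr0.
by rewrite subr_ge0 ler_pdivrMr ?mul1r ?ge_min ?lexx// lt_def nui_neq0 cell_mass_ge0.
Qed.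

Lemma residual_ge0 nu mu x : 0 <= residual nu mu x.
Proof. by apply: sumr_ge0 => i _; rewrite mulr_ge0 ?residual_coef_ge0. Qed.

Lemma measurable_residual nu mu : measurable_fun setT (residual nu mu).
Proof. by apply: measurable_sum => i; exact: measurable_funM. Qed.

Lemma residual_coefM nu mu i :
  (1 - overlap nu mu i / cell_mass nu i) * cell_mass nu i =
  cell_mass nu i - overlap nu mu i.
Proof.
have [nui0|nui_neq0] := eqVneq (cell_mass nu i) 0; last by rewrite mulrBl mul1r divfK.
by rewrite /overlap nui0 min_l ?cell_mass_ge0// mulr0 subr0.
Qed.

Lemma integralM_residual nu mu (u : T -> R) : measurable_fun setT u ->
  (forall x, 0 <= u x) ->
  (\int[nu]_x (u x * residual nu mu x)%:E =
   \sum_i (1 - overlap nu mu i / cell_mass nu i)%:E * \int[nu]_x (u x * psi i x)%:E)%E.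
Proof.
move=> meas_u u0; under eq_integral do rewrite mulr_sumr.
rewrite ge0_integral_sum_real; last 2 first.
- by move=> i; do 2?apply: measurable_funM.
- by move=> i x; rewrite !mulr_ge0 ?residual_coef_ge0.
apply: eq_bigr => i _; under eq_integral do rewrite mulrCA.
rewrite ge0_integralZl_real ?residual_coef_ge0//; first exact: measurable_funM.
by move=> x; rewrite mulr_ge0.
Qed.

Lemma integral_residual nu mu : (\int[nu]_x (residual nu mu x)%:E = (deficit nu mu)%:E)%E.
Proof.
under eq_integral do rewrite -[residual _ _ _]mul1r.
rewrite (@integralM_residual nu mu (fun=> 1))//.
have -> : deficit nu mu = \sum_i (cell_mass nu i - overlap nu mu i).
  by rewrite sumrB sum_cell_mass.
rewrite -sumEFin.
apply: eq_bigr => i _; under eq_integral do rewrite /= mul1r.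
by rewrite cell_massE -EFinM residual_coefM.
Qed.

Lemma overlap_density_ge0 nu mu z : 0 <= overlap_density nu mu z.
Proof.
rewrite addr_ge0//; last by rewrite mulr_ge0 ?invr_ge0 ?deficit_ge0// mulr_ge0 ?residual_ge0.
apply: sumr_ge0 => i _; rewrite mulr_ge0 ?divr_ge0 ?overlap_ge0// mulr_ge0//.
  exact: cell_mass_ge0.
exact: cell_mass_ge0.
Qed.

Let measurable_tensor (u v : T -> R) : measurable_fun setT u -> measurable_fun setT v ->
  measurable_fun setT (fun z : T * T => u z.1 * v z.2).
Proof.
move=> mu mv; apply: measurable_funM.
  exact: measurableT_comp mu measurable_fst.
exact: measurableT_comp mv measurable_snd.
Qed.

Lemma measurable_overlap_density nu mu : measurable_fun setT (overlap_density nu mu).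
Proof.
apply: measurable_funD.
  by apply: measurable_sum => i; apply: measurable_funM => //; exact: measurable_tensor.
by apply: measurable_funM => //; apply: measurable_tensor; exact: measurable_residual.
Qed.

Definition overlap_plan nu mu : {measure set (T * T) -> \bar R} :=
  mdensity (nu \x mu)%E (measurable_overlap_density nu mu) (overlap_density_ge0 nu mu).

Lemma integral_overlap_plan nu mu (F : T * T -> R) : measurable_fun setT F ->
  (forall z, 0 <= F z) ->
  (\int[overlap_plan nu mu]_z (F z)%:E =
   \sum_i (overlap nu mu i / (cell_mass nu i * cell_mass mu i))%:E *
     \int[nu \x mu]_z (F z * (psi i z.1 * psi i z.2))%:E +
   (deficit nu mu)^-1%:E *
     \int[nu \x mu]_z (F z * (residual nu mu z.1 * residual mu nu z.2))%:E)%E.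
Proof.
move=> mF F0; rewrite ge0_integral_mdensity//.
have coef_ge0 i : 0 <= overlap nu mu i / (cell_mass nu i * cell_mass mu i).
  by rewrite divr_ge0 ?overlap_ge0// mulr_ge0 ?cell_mass_ge0.
have mcell i : measurable_fun setT (fun z : T * T => F z * (psi i z.1 * psi i z.2)).
  by apply: measurable_funM => //; exact: measurable_tensor.
have mres : measurable_fun setT
    (fun z : T * T => F z * (residual nu mu z.1 * residual mu nu z.2)).
  by apply: measurable_funM => //; apply: measurable_tensor; exact: measurable_residual.
have cell_ge0 i z : 0 <= F z * (psi i z.1 * psi i z.2) by rewrite !mulr_ge0.
have res_ge0 z : 0 <= F z * (residual nu mu z.1 * residual mu nu z.2).
  by rewrite !mulr_ge0 ?residual_ge0.
under eq_integral do rewrite mulrDr mulr_sumr [F _ * (_^-1 * _)]mulrCA.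
under eq_integral do under eq_bigr do rewrite mulrCA.
rewrite ge0_integralD_real; last 4 first.
- by apply: measurable_sum => i; exact: measurable_funM.
- by move=> z; apply: sumr_ge0 => i _; rewrite mulr_ge0.
- exact: measurable_funM.
- by move=> z; rewrite mulr_ge0// invr_ge0 deficit_ge0.
rewrite ge0_integralZl_real ?invr_ge0 ?deficit_ge0//; congr (_ + _)%E.
rewrite ge0_integral_sum_real; last 2 first.
- by move=> i; exact: measurable_funM.
- by move=> i z; rewrite mulr_ge0.
by apply: eq_bigr => i _; rewrite ge0_integralZl_real.
Qed.

Lemma overlap_plan_rect nu mu (A B : set T) : measurable A -> measurable B ->
  overlap_plan nu mu (A `*` B) =
  (\sum_i overlap nu mu i / (cell_mass nu i * cell_mass mu i) *
     (cell_mass_in nu A i * cell_mass_in mu B i) +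
   (deficit nu mu)^-1 *
     ((\sum_i (1 - overlap nu mu i / cell_mass nu i) * cell_mass_in nu A i) *
      (\sum_i (1 - overlap mu nu i / cell_mass mu i) * cell_mass_in mu B i)))%:E.
Proof.
move=> mA mB.
have mtensor (f g : T -> R) : measurable_fun setT f -> measurable_fun setT g ->
    measurable_fun setT (fun z : T * T => f z.1 * g z.2) by exact: measurable_tensor.
transitivity (\int[overlap_plan nu mu]_z ((\1_A z.1 : R) * \1_B z.2)%:E)%E.
  transitivity (\int[overlap_plan nu mu]_z (\1_(A `*` B) z)%:E)%E.
    by rewrite integral_indic ?setIT//; exact: measurableX.
  apply: eq_integral => z _; rewrite !indicE in_setX.
  by case: (_ \in A); case: (_ \in B); rewrite ?mulr1 ?mulr0.
rewrite integral_overlap_plan//; last exact: mtensor.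
under eq_bigr do under eq_integral do rewrite mulrACA.
under [X in (_ + _ * X)%E]eq_integral do rewrite mulrACA.
under eq_bigr => i _.
  rewrite (ge0_integral_product nu mu (u := fun x => \1_A x * psi i x)
    (v := fun x => \1_B x * psi i x))//; [|exact: measurable_cell_in..].
  rewrite !cell_mass_inE -!EFinM; over.
have mres m m' (D : set T) : measurable D ->
    measurable_fun setT (fun x => \1_D x * residual m m' x).
  by move=> mD; exact: measurable_funM (measurable_indic mD) (measurable_residual _ _).
have res_ge0 m m' (D : set T) x : 0 <= \1_D x * residual m m' x.
  by rewrite mulr_ge0 ?residual_ge0.
rewrite (ge0_integral_product nu mu (u := fun x => \1_A x * residual nu mu x)
  (v := fun x => \1_B x * residual mu nu x))//; [|exact: mres..].
have resE m m' (D : set T) : measurable D -> (\int[m]_x (\1_D x * residual m m' x)%:E =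
    (\sum_i (1 - overlap m m' i / cell_mass m i) * cell_mass_in m D i)%:E)%E.
  move=> mD; rewrite (integralM_residual _ _ (measurable_indic mD))//.
  by rewrite -sumEFin; apply: eq_bigr => i _; rewrite cell_mass_inE EFinM.
by rewrite !resE// sumEFin -!EFinM -EFinD.
Qed.

Lemma sum_cell_mass_in m (A : set T) : measurable A ->
  (\sum_i cell_mass_in m A i)%:E = m A.
Proof.
move=> mA; rewrite -sumEFin -[in RHS](setIT A) -integral_indic//.
under eq_bigr do rewrite -cell_mass_inE.
by rewrite sum_cell_integral//; exact: measurable_indic.
Qed.

Lemma overlap_plan_marginals nu mu (A : set T) : measurable A ->
  overlap_plan nu mu (A `*` setT) = nu A /\ overlap_plan nu mu (setT `*` A) = mu A.
Proof.
move=> mA; rewrite !overlap_plan_rect//.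
have sum_coefM m m' : \sum_i (1 - overlap m m' i / cell_mass m i) * cell_mass_in m setT i =
    deficit m m'.
  rewrite /deficit -[in RHS](sum_cell_mass m) -sumrB; apply: eq_bigr => i _.
  by rewrite cell_mass_setT residual_coefM.
have marginal m m' := overlap_marginal (cell_mass_in_bounds m A) (cell_mass_ge0 m')
  (sum_cell_mass m).
rewrite !sum_coefM -!sum_cell_mass_in// -(marginal nu mu) -(marginal mu nu).
split; congr (_ + _)%:E.
- by apply: eq_bigr => i _; rewrite cell_mass_setT.
- by rewrite -/(deficit nu mu) deficitC mulrCA [(_^-1 * _)%R]mulrC.
- apply: eq_bigr => i _; rewrite cell_mass_setT overlapC -/(overlap mu nu i).
  by rewrite [cell_mass nu i * cell_mass mu i]mulrC [cell_mass nu i * _]mulrC.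
- by rewrite mulrA mulrC [_^-1 * _]mulrC deficitC.
Qed.

Lemma overlap_ratio_le1 nu mu i :
  overlap nu mu i / (cell_mass nu i * cell_mass mu i) * cell_mass mu i <= 1.
Proof.
have [mui0|mui_neq0] := eqVneq (cell_mass mu i) 0; first by rewrite mui0 mulr0 ler01.
rewrite invfM mulrA divfK//; have [->|nui_neq0] := eqVneq (cell_mass nu i) 0.
  by rewrite invr0 mulr0 ler01.
by rewrite ler_pdivrMr ?mul1r ?ge_min ?lexx// lt_def nui_neq0 cell_mass_ge0.
Qed.

Lemma ge0_integral_tensorD nu mu (u f g : T -> R) :
  measurable_fun setT u -> (forall x, 0 <= u x) ->
  measurable_fun setT f -> (forall x, 0 <= f x) ->
  measurable_fun setT g -> (forall x, 0 <= g x) ->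
  (\int[nu \x mu]_z ((u z.1 + u z.2) * (f z.1 * g z.2))%:E =
   \int[nu]_x (u x * f x)%:E * \int[mu]_x (g x)%:E +
   \int[nu]_x (f x)%:E * \int[mu]_x (u x * g x)%:E)%E.
Proof.
move=> meas_u u0 mf f0 mg g0.
have muf : measurable_fun setT (fun x => u x * f x) by exact: measurable_funM.
have mug : measurable_fun setT (fun x => u x * g x) by exact: measurable_funM.
under eq_integral do rewrite mulrDl mulrA [u _.2 * _]mulrCA.
rewrite ge0_integralD_real; last 4 first.
- exact: (@measurable_tensor (fun x => u x * f x) g).
- by move=> z; rewrite !mulr_ge0.
- exact: (@measurable_tensor f (fun x => u x * g x)).
- by move=> z; rewrite !mulr_ge0.
rewrite (ge0_integral_product nu mu (u := fun x => u x * f x) (v := g))//; last first.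
  by move=> x; rewrite mulr_ge0.
rewrite (ge0_integral_product nu mu (u := f) (v := fun x => u x * g x))//.
by move=> x; rewrite mulr_ge0.
Qed.

Lemma integralM_residual_le nu mu (l : 'I_k) (u : T -> R) (Q N : R) :
  measurable_fun setT u -> (forall x, 0 <= u x) -> 0 <= Q ->
  (forall i x, i != l -> psi i x != 0 -> u x <= Q) ->
  (\int[nu]_x (u x * psi l x)%:E = N%:E)%E ->
  (\int[nu]_x (u x * residual nu mu x)%:E <=
  (N + Q * \sum_i `|cell_mass nu i - cell_mass mu i|)%:E)%E.
Proof.
move=> meas_u u0 Q0 u_cell NE; have N_ge0 : 0 <= N.
  by rewrite -lee_fin -NE integral_ge0// => x _; rewrite lee_fin mulr_ge0.
rewrite integralM_residual// (bigD1 l)//= NE mulr_sumr [in leRHS](bigD1 l)//= addrA [leRHS]EFinD.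
apply: leeD.
  rewrite -EFinM lee_fin (@le_trans _ _ N) ?lerDl ?mulr_ge0// ler_piMl//.
  by rewrite lerBlDr lerDl divr_ge0 ?overlap_ge0 ?cell_mass_ge0.
rewrite -sumEFin; apply: lee_sum => i il.
apply: (@le_trans _ _ ((1 - overlap nu mu i / cell_mass nu i)%:E *
    (Q * cell_mass nu i)%:E)%E).
  apply: lee_wpmul2l; first by rewrite lee_fin residual_coef_ge0.
  rewrite EFinM -cell_massE -ge0_integralZl_real//.
  apply: ge0_le_integral_pointwise => x; rewrite lee_fin ?mulr_ge0//.
  have [->|xi] := eqVneq (psi i x) 0; first by rewrite !mulr0.
  by rewrite ler_wpM2r// (u_cell _ _ il).
rewrite -EFinM lee_fin mulrCA ler_wpM2l// residual_coefM /overlap.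
by have [ab|ba] := leP (cell_mass nu i) (cell_mass mu i); rewrite ?subrr ?ler_norm.
Qed.

Section cost.
Variables (nu mu : P) (l : 'I_k) (u : T -> R) (F : T * T -> R) (delta Q N M : R).
Hypothesis meas_u : measurable_fun setT u.
Hypothesis u_ge0 : forall x, 0 <= u x.
Hypothesis mF : measurable_fun setT F.
Hypothesis F_le : forall z, 0 <= F z <= u z.1 + u z.2.
Hypothesis delta_ge0 : 0 <= delta.
Hypothesis F_cell : forall i z,
  i != l -> psi i z.1 != 0 -> psi i z.2 != 0 -> F z <= delta.
Hypothesis Q_ge0 : 0 <= Q.
Hypothesis u_cell : forall i x, i != l -> psi i x != 0 -> u x <= Q.
Hypothesis NE : (\int[nu]_x (u x * psi l x)%:E = N%:E)%E.
Hypothesis ME : (\int[mu]_x (u x * psi l x)%:E = M%:E)%E.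

Let F_ge0 z : 0 <= F z. Proof. by have /andP[] := F_le z. Qed.

Let integral_ge0_real m (g : T -> R) (r : R) :
  (forall x, 0 <= g x) -> (\int[m]_x (g x)%:E = r%:E)%E -> 0 <= r.
Proof. by move=> g0 gr; rewrite -lee_fin -gr integral_ge0// => x _; rewrite lee_fin. Qed.

Let N_ge0 : 0 <= N. Proof. by apply: integral_ge0_real NE => x; rewrite mulr_ge0. Qed.

Let M_ge0 : 0 <= M. Proof. by apply: integral_ge0_real ME => x; rewrite mulr_ge0. Qed.

Let integral_tensor_le (f g : T -> R) :
  measurable_fun setT f -> (forall x, 0 <= f x) ->
  measurable_fun setT g -> (forall x, 0 <= g x) ->
  (\int[nu \x mu]_z (F z * (f z.1 * g z.2))%:E <=
   \int[nu]_x (u x * f x)%:E * \int[mu]_x (g x)%:E +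
   \int[nu]_x (f x)%:E * \int[mu]_x (u x * g x)%:E)%E.
Proof.
move=> mf f0 mg g0; rewrite -ge0_integral_tensorD//.
apply: ge0_le_integral_pointwise => z; rewrite lee_fin; first by rewrite !mulr_ge0.
by rewrite ler_wpM2r ?mulr_ge0//; have /andP[] := F_le z.
Qed.

Lemma cell_cost_le i :
  ((overlap nu mu i / (cell_mass nu i * cell_mass mu i))%:E *
     \int[nu \x mu]_z (F z * (psi i z.1 * psi i z.2))%:E <=
   (delta * overlap nu mu i + (i == l)%:R * (N + M))%:E)%E.
Proof.
set a := cell_mass nu i; set b := cell_mass mu i; set r := _ / (a * b).
have r_ge0 : (0 <= r%:E)%E by rewrite lee_fin divr_ge0 ?overlap_ge0 ?mulr_ge0 ?cell_mass_ge0.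
have rb_le1 : r * b <= 1 := overlap_ratio_le1 nu mu i.
have ra_le1 : r * a <= 1.
  by rewrite /r overlapC [a * b]mulrC; exact: overlap_ratio_le1.
have [li|il] := eqVneq i l; last first.
  rewrite mul0r addr0; apply: (@le_trans _ _ (r%:E * (delta * (a * b))%:E)%E).
    apply: lee_wpmul2l => //; rewrite EFinM EFinM -!cell_massE.
    rewrite -(ge0_integral_product nu mu (u := psi i) (v := psi i))//.
    rewrite -ge0_integralZl_real//; [|exact: measurable_tensor|by move=> z; rewrite mulr_ge0].
    apply: ge0_le_integral_pointwise => z; rewrite lee_fin ?mulr_ge0//.
    have [->|z1] := eqVneq (psi i z.1) 0; first by rewrite mul0r !mulr0.
    have [->|z2] := eqVneq (psi i z.2) 0; first by rewrite !mulr0.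
    by rewrite ler_wpM2r ?mulr_ge0// (F_cell il).
  rewrite -EFinM lee_fin mulrCA ler_wpM2l// mulrC /r.
  have [->|ab_neq0] := eqVneq (a * b) 0; last by rewrite mulrC divfK.
  by rewrite mul0r overlap_ge0.
rewrite mul1r; apply: (@le_trans _ _ (r%:E * (N * b + a * M)%:E)%E).
  apply: lee_wpmul2l => //; apply: le_trans (integral_tensor_le _ _ _ _) _ => //.
  by rewrite li NE ME -li !cell_massE EFinD !EFinM.
rewrite -EFinM lee_fin mulrDr -[leLHS]add0r; apply: lerD.
  by rewrite mulr_ge0// overlap_ge0.
by apply: lerD; [rewrite mulrCA ler_piMr|rewrite mulrA ler_piMl].
Qed.

Let D : R := \sum_i `|cell_mass nu i - cell_mass mu i|.

Let D_ge0 : 0 <= D. Proof. exact: sumr_ge0. Qed.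

Lemma residual_cost_le :
  ((deficit nu mu)^-1%:E *
     \int[nu \x mu]_z (F z * (residual nu mu z.1 * residual mu nu z.2))%:E <=
   (N + M + 2 * Q * D)%:E)%E.
Proof.
set s := deficit nu mu; have s_ge0 : 0 <= s := deficit_ge0 nu mu.
have total_ge0 : 0 <= N + M + 2 * Q * D by rewrite !addr_ge0// !mulr_ge0.
apply: (@le_trans _ _ (s^-1%:E * (s * (N + M + 2 * Q * D))%:E)%E); last first.
  rewrite -EFinM lee_fin mulrA; have [->|s_neq0] := eqVneq s 0; last by rewrite mulVf// mul1r.
  by rewrite mulr0 mul0r.
apply: lee_wpmul2l; first by rewrite lee_fin invr_ge0.
apply: le_trans (integral_tensor_le (measurable_residual _ _) (residual_ge0 _ _)
  (measurable_residual _ _) (residual_ge0 _ _)) _.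
have nu_le := integralM_residual_le mu meas_u u_ge0 Q_ge0 u_cell NE.
have := integralM_residual_le nu meas_u u_ge0 Q_ge0 u_cell ME.
have -> : \sum_i `|cell_mass mu i - cell_mass nu i| = D.
  by apply: eq_bigr => i _; exact: distrC.
rewrite !integral_residual -(deficitC nu mu) -/s => mu_le.
have -> : s * (N + M + 2 * Q * D) = (N + Q * D) * s + s * (M + Q * D) by ring.
by rewrite [leRHS]EFinD [in leRHS]EFinM [in leRHS]EFinM; apply: leeD;
  [apply: lee_wpmul2r|apply: lee_wpmul2l];
  rewrite ?lee_fin.
Qed.

Lemma overlap_plan_cost_le :
  (\int[overlap_plan nu mu]_z (F z)%:E <=
   (delta + 2 * (N + M) + 2 * Q * \sum_i `|cell_mass nu i - cell_mass mu i|)%:E)%E.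
Proof.
rewrite integral_overlap_plan//.
apply: le_trans (leeD (lee_sum _ (fun i _ => cell_cost_le i)) residual_cost_le) _.
rewrite sumEFin -EFinD lee_fin -/D big_split/= -mulr_sumr -mulr_suml.
have -> : \sum_i (i == l)%:R = 1 :> R.
  by rewrite (bigD1 l)//= eqxx big1 ?addr0// => i /negbTE ->.
rewrite mul1r; have : delta * (\sum_i overlap nu mu i) <= delta.
  by rewrite ler_piMr// sum_overlap_le1.
by lra.
Qed.

End cost.

End overlap_coupling.

(** * Wasserstein neighbourhoods *)

Section marginal.
Context d1 d2 (T1 : measurableType d1) (T2 : measurableType d2) (R : realType).
Variables (pi : {measure set T1 -> \bar R}) (nu : {measure set T2 -> \bar R}).
Variables (h : T1 -> T2) (mh : measurable_fun setT h).
Hypothesis pi_h : forall A, measurable A -> pi (h @^-1` A) = nu A.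
Local Open Scope ereal_scope.

Lemma ge0_integral_marginal (g : T2 -> \bar R) : measurable_fun setT g ->
  (forall x, 0 <= g x) -> \int[pi]_z g (h z) = \int[nu]_x g x.
Proof.
move=> mg g0.
have := ge0_integral_pushforward mh pi measurableT mg (fun x _ => g0 x).
by rewrite preimage_setT => <-; apply: eq_measure_integral => A mA _; exact: pi_h.
Qed.

Lemma integrable_marginal (g : T2 -> \bar R) : nu.-integrable setT g ->
  pi.-integrable setT (g \o h).
Proof.
move=> /integrableP[mg g_fin]; apply/integrableP; split; first exact: measurableT_comp.
by rewrite (ge0_integral_marginal (g := fun x => `|g x|))//; exact: measurableT_comp.
Qed.

Lemma integral_marginal (g : T2 -> \bar R) : nu.-integrable setT g ->
  \int[pi]_z g (h z) = \int[nu]_x g x.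
Proof.
move=> /integrableP[mg _]; rewrite integralE [RHS]integralE.
under [X in X - _]eq_integral do rewrite (funepos_comp g h)/=.
under [X in _ - X]eq_integral do rewrite (funeneg_comp g h)/=.
rewrite (ge0_integral_marginal (measurable_funepos mg))//.
by rewrite (ge0_integral_marginal (measurable_funeneg mg)).
Qed.

End marginal.

Section wasserstein.
Variables (R : realType) (d : nat) (p : R).
Hypothesis p_gt0 : 0 < p.
Local Notation Rd := (Rd R d).
Local Notation P := (probability Rd R).
Implicit Types (x y : Rd) (phi : Rd -> R) (mu nu : P) (pi : probability (Rd * Rd)%type R).

Let p0 : 0 <= p. Proof. exact: ltW. Qed.

Lemma product_coupling nu mu : coupling nu mu (nu \x mu : probability (Rd * Rd)%type R)%E.
Proof.
move=> A mA; split.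
  by rewrite -[RHS]mule1 -(probability_setT mu); exact: product_measure1E.
by rewrite -[RHS]mul1e -(probability_setT nu); exact: product_measure1E.
Qed.

Lemma coupling_fst nu mu pi : coupling nu mu pi ->
  forall A, measurable A -> pi (fst @^-1` A) = nu A.
Proof. by move=> cpi A /cpi[<- _]; congr (pi _); apply/seteqP; split=> z /=; [|case]. Qed.

Lemma coupling_snd nu mu pi : coupling nu mu pi ->
  forall A, measurable A -> pi (snd @^-1` A) = mu A.
Proof. by move=> cpi A /cpi[_ <-]; congr (pi _); apply/seteqP; split=> z /=; [|case]. Qed.

Lemma norm_mintB_le_coupling nu mu pi phi : Pp p nu -> Pp p mu -> coupling nu mu pi ->
  testfun p phi ->
  (`|mint nu phi - mint mu phi|%:E <= \int[pi]_z `|phi z.1 - phi z.2|%:E)%E.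
Proof.
move=> nup mup cpi tphi.
have int_nu := testfun_integrable p0 nup tphi.
have int_mu := testfun_integrable p0 mup tphi.
have int1 := integrable_marginal measurable_fst (coupling_fst cpi) int_nu.
have int2 := integrable_marginal measurable_snd (coupling_snd cpi) int_mu.
have -> : (`|mint nu phi - mint mu phi|%:E =
    `| \int[pi]_z ((phi z.1)%:E - (phi z.2)%:E) |)%E.
  rewrite (integralB measurableT int1 int2).
  rewrite (integral_marginal measurable_fst (coupling_fst cpi) int_nu).
  rewrite (integral_marginal measurable_snd (coupling_snd cpi) int_mu).
  by rewrite -!(mintE p0)// -EFinB.
apply: le_abse_integral => //.
exact: emeasurable_funB (measurable_int _ int1) (measurable_int _ int2).
Qed.

Lemma powR_dist_le x y : dist x y `^ p <= 2 `^ p * npow p x + 2 `^ p * npow p y.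
Proof.
rewrite -mulrDr (@le_trans _ _ ((enorm x + enorm y) `^ p))//.
  apply: ge0_ler_powR; rewrite ?nnegrE ?addr_ge0 ?enorm_ge0 ?dist_ge0//.
  exact: dist_le_enormD.
by apply: ler_powRD => //; exact: enorm_ge0.
Qed.

Lemma weight_le_dist x y : weight p x <= 2 `^ p * (weight p y + dist x y `^ p).
Proof.
have two_p := powR2_ge1 p0.
rewrite /weight -addrA mulrDr mulr1 lerD//.
rewrite (@le_trans _ _ ((enorm y + dist x y) `^ p))//.
  apply: ge0_ler_powR; rewrite ?nnegrE ?addr_ge0 ?enorm_ge0 ?dist_ge0//.
  exact: ler_enormD_dist.
by apply: ler_powRD => //; [exact: enorm_ge0|exact: dist_ge0].
Qed.

Lemma measurable_powR_dist :
  measurable_fun setT (fun z : Rd * Rd => dist z.1 z.2 `^ p).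
Proof. exact: (measurableT_comp (measurable_powR p) (@measurable_dist R d)). Qed.

Definition cost pi : \bar R := (\int[pi]_z (dist z.1 z.2 `^ p)%:E)%E.

Lemma cost_ge0 pi : (0 <= cost pi)%E.
Proof. by apply: integral_ge0 => z _; rewrite lee_fin powR_ge0. Qed.

Lemma cost_lty nu mu pi : Pp p nu -> Pp p mu -> coupling nu mu pi -> (cost pi < +oo)%E.
Proof.
move=> nup mup cpi; pose c_npow x := 2 `^ p * npow p x.
have tc : testfun p c_npow := testfunZ _ (testfun_npow d p0).
apply: (@le_lt_trans _ _ (\int[pi]_z (c_npow z.1 + c_npow z.2)%:E)%E).
  apply: ge0_le_integral_pointwise => z; rewrite lee_fin ?powR_ge0//.
  exact: powR_dist_le.
have int1 := integrable_marginal measurable_fst (coupling_fst cpi) (testfun_integrable p0 nup tc).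
have int2 := integrable_marginal measurable_snd (coupling_snd cpi) (testfun_integrable p0 mup tc).
rewrite -ge0_fin_numE; last first.
  by apply: integral_ge0 => z _; rewrite lee_fin addr_ge0// mulr_ge0 ?powR_ge0.
under eq_integral do rewrite EFinD.
by have := integrable_fin_num measurableT (integrableD measurableT int1 int2).
Qed.

Lemma Wp_ltP nu mu (e : R) : Pp p nu -> Pp p mu -> 0 < e ->
  Wp p nu mu < e <-> exists2 pi, coupling nu mu pi & (cost pi < (e `^ p)%:E)%E.
Proof.
move=> nup mup e0; rewrite /Wp.
set S := [set _ | _ in _]; set I := ereal_inf S.
have I0 : (0 <= I)%E by apply: le_ereal_inf_tmp => _ [pi _ <-]; exact: cost_ge0.
have I_lty : (I < +oo)%E.
  apply: le_lt_trans (cost_lty nup mup (product_coupling nu mu)).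
  by apply: ereal_inf_lbound; exists (nu \x mu)%E => //; exact: product_coupling.
have IE : I = (fine I)%:E by rewrite fineK// ge0_fin_numE.
have rootK (t : R) : 0 <= t -> (t `^ p^-1) `^ p = t.
  by move=> t0; rewrite -powRrM mulVf ?gt_eqF// powRr1.
have powRK (t : R) : 0 <= t -> (t `^ p) `^ p^-1 = t.
  by move=> t0; rewrite -powRrM mulfV ?gt_eqF// powRr1.
split=> [Ie|[pi cpi pi_cost]].
  have /ereal_inf_lt[_ [pi cpi <-] pi_cost] : (I < (e `^ p)%:E)%E.
    rewrite IE lte_fin -(rootK (fine I)) ?fine_ge0//.
    by apply: gt0_ltr_powR; rewrite ?nnegrE ?powR_ge0 ?ltW.
  by exists pi.
rewrite -(powRK e (ltW e0)).
apply: gt0_ltr_powR; rewrite ?invr_gt0// ?nnegrE ?powR_ge0 ?fine_ge0//.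
by rewrite -lte_fin -IE (le_lt_trans _ pi_cost)//; apply: ereal_inf_lbound; exists pi.
Qed.

Lemma testfun_oscillation phi : testfun p phi -> exists2 C : R, 0 < C &
  forall e r : R, 0 < e -> 0 <= r -> exists2 K : R, 0 < K & forall x y,
    `|phi x - phi y| <= e + K * dist x y `^ p + C * tail p r y.
Proof.
move=> tphi; have [B B0 phiB] := testfun_bound tphi.
set q := 2 `^ p; have q0 : 0 < q by rewrite powR_gt0.
have [A A0 crude] : exists2 A, 0 < A & forall x y,
    `|phi x - phi y| <= B * q * dist x y `^ p + A * weight p y.
  exists (B * (q + 1)) => [|x y]; first by rewrite mulr_gt0// addr_gt0.
  apply: (@le_trans _ _ (B * (weight p x + weight p y))).
    by rewrite (le_trans (ler_normB _ _))// mulrDr lerD.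
  rewrite -!mulrA -mulrDr ler_pM2l//; have := weight_le_dist x y; rewrite -/q.
  by lra.
exists A => // e r e0 r0; have unif := unif_continuous_enorm_le (r + 1) tphi.1 e0.
have [del [close del0]] := filter_ex (filterI unif (nbhs_right_gt 0)).
have delp0 : 0 < del `^ p by rewrite powR_gt0.
pose b := 1 + (r + 1) `^ p; have b0 : 0 < b by rewrite ltr_wpDr ?powR_ge0.
have Ab0 : 0 < A * b / del `^ p by apply: divr_gt0 => //; exact: mulr_gt0.
exists (B * q + A * b / del `^ p); first by apply: addr_gt0 => //; exact: mulr_gt0.
move=> x y; have D0 : 0 <= dist x y `^ p by rewrite powR_ge0.
have Atail0 : 0 <= A * tail p r y by rewrite mulr_ge0 ?tail_ge0 ?ltW.
have AbD0 : 0 <= A * b / del `^ p * dist x y `^ p by rewrite mulr_ge0// ltW.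
have BqD0 : 0 <= B * q * dist x y `^ p by rewrite mulr_ge0// mulr_ge0 ?ltW.
rewrite mulrDl; have [ry|/ltW yr] := leP (r + 1) (enorm y).
  by have := crude x y; rewrite tail_eq_weight//; lra.
have [xy|xy] := ltP (dist x y) del.
  have : `|phi x - phi y| < e by rewrite distrC close// distC.
  by lra.
have wy : weight p y <= b.
  by rewrite lerD2l; apply: ge0_ler_powR; rewrite ?nnegrE ?enorm_ge0 ?addr_ge0.
have : A * weight p y <= A * b / del `^ p * dist x y `^ p.
  rewrite -!mulrA ler_pM2l// (le_trans wy)// ler_peMr ?(ltW b0)//.
  rewrite mulrC ler_pdivlMr// mul1r.
  by apply: ge0_ler_powR; rewrite ?nnegrE ?dist_ge0// ltW.
by have := crude x y; lra.
Qed.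

Lemma integral_oscillation nu mu pi (e K C r : R) : Pp p mu -> coupling nu mu pi ->
  0 <= e -> 0 <= K -> 0 <= C ->
  (\int[pi]_z (e + K * dist z.1 z.2 `^ p + C * tail p r z.2)%:E =
   e%:E + K%:E * cost pi + C%:E * (mint mu (tail p r))%:E)%E.
Proof.
move=> mup cpi e0 K0 C0; have mD := measurable_powR_dist.
have D0 (z : Rd * Rd) : 0 <= dist z.1 z.2 `^ p by rewrite powR_ge0.
have mtail : measurable_fun setT (fun x : Rd => (tail p r x)%:E).
  by apply/measurable_EFinP; exact: measurable_testfun (testfun_tail d p0 r).
have mtail2 : measurable_fun setT (fun z : Rd * Rd => tail p r z.2).
  exact: measurableT_comp (measurable_testfun (testfun_tail d p0 r)) measurable_snd.
have tail0 (z : Rd * Rd) : 0 <= tail p r z.2 by exact: tail_ge0.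
rewrite (mintE p0 mup (testfun_tail d p0 r)).
rewrite -(ge0_integral_marginal measurable_snd (coupling_snd cpi) mtail)/=; last first.
  by move=> x; rewrite lee_fin tail_ge0.
rewrite ge0_integralD_real; last 4 first.
- by apply: measurable_funD => //; exact: measurable_funM.
- by move=> z; rewrite addr_ge0 ?mulr_ge0.
- exact: measurable_funM.
- by move=> z; rewrite mulr_ge0.
rewrite ge0_integralD_real//; [|exact: measurable_funM|by move=> z; rewrite mulr_ge0].
by rewrite !ge0_integralZl_real// integral_cst//= probability_setT mule1.
Qed.

Lemma Wp_mint_close mu phi (e : R) : Pp p mu -> testfun p phi -> 0 < e ->
  exists2 del : R, 0 < del & forall nu, Pp p nu -> Wp p nu mu < del ->
    `|mint nu phi - mint mu phi| < e.
Proof.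
move=> mup tphi e0; have [C C0 osc] := testfun_oscillation tphi.
have e30 : 0 < e / 3 by rewrite divr_gt0.
have [r near_tail] := near_mint_tail_lt p0 mup (divr_gt0 e30 C0).
have mu_tail := tnbhs_singleton mup near_tail.
have [K K0 phi_osc] := osc _ r%:R e30 (ler0n _ _).
have eK0 : 0 < e / 3 / K by rewrite divr_gt0.
exists ((e / 3 / K) `^ p^-1); first by rewrite powR_gt0.
move=> nu nup /(Wp_ltP nup mup (powR_gt0 _ eK0))[pi cpi].
rewrite -powRrM mulVf ?gt_eqF// powRr1 ?(ltW eK0)// => pi_cost.
have costE : cost pi = (fine (cost pi))%:E.
  by rewrite fineK// ge0_fin_numE ?cost_ge0// (cost_lty nup mup cpi).
rewrite -lte_fin (le_lt_trans (norm_mintB_le_coupling nup mup cpi tphi))//.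
apply: (@le_lt_trans _ _ (\int[pi]_z
    (e / 3 + K * dist z.1 z.2 `^ p + C * tail p r%:R z.2)%:E)%E).
  by apply: ge0_le_integral_pointwise => z; rewrite lee_fin.
rewrite (integral_oscillation r%:R mup cpi (ltW e30) (ltW K0) (ltW C0)).
rewrite costE -!EFinM -!EFinD lte_fin.
have : K * fine (cost pi) < e / 3 by rewrite mulrC -ltr_pdivlMr// -lte_fin -costE.
have : C * mint mu (tail p r%:R) < e / 3 by rewrite mulrC -ltr_pdivlMr.
by lra.
Qed.

End wasserstein.

Section wasserstein_neighbourhoods.
Variables (R : realType) (d : nat) (p : R).
Local Notation Rd := (Rd R d).
Local Notation P := (probability Rd R).
Local Notation net_size := (@net_size R d).
Implicit Types (x : Rd) (phi : Rd -> R) (mu nu : P).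

Definition node_bound n : R := 2 `^ p * \sum_(i < (net_size n).+1) (enorm (node i) + 1) `^ p.

Lemma node_bound_ge0 n : 0 <= node_bound n.
Proof. by rewrite mulr_ge0 ?powR_ge0// sumr_ge0// => i _; exact: powR_ge0. Qed.

Lemma npow_le_node_bound n (i : 'I_(net_size n).+1) x : 0 <= p ->
  i != ord_max -> pou i x != 0 -> 2 `^ p * npow p x <= node_bound n.
Proof.
move=> p0 i_max xi; rewrite ler_wpM2l ?powR_ge0// (bigD1 i)//=.
apply: (@le_trans _ _ ((enorm (node i) + 1) `^ p)); last first.
  by rewrite lerDl sumr_ge0// => j _; exact: powR_ge0.
apply: ge0_ler_powR; rewrite ?nnegrE ?enorm_ge0 ?addr_ge0 ?enorm_ge0//.
rewrite (le_trans (ler_enormD_dist _ (node i)))// lerD2l ltW//.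
by rewrite (lt_le_trans (dist_node_lt i_max xi))// invf_le1// ler1n.
Qed.

Lemma dist_same_cell_le n (i : 'I_(net_size n).+1) x y : 0 <= p ->
  i != ord_max -> pou i x != 0 -> pou i y != 0 -> dist x y `^ p <= (2 * n.+1%:R^-1) `^ p.
Proof.
move=> p0 i_max xi yi; apply: ge0_ler_powR; rewrite ?nnegrE ?dist_ge0 ?mulr_ge0//.
rewrite (le_trans (dist_triangle (node i) _ _))// mulr_natl mulr2n lerD//.
  by rewrite ltW// dist_node_lt.
by rewrite distC ltW// dist_node_lt.
Qed.

Lemma npow_pou_ord_max_le n (r : R) x : r + 1 <= n%:R ->
  npow p x * @pou R d n ord_max x <= tail p r x.
Proof.
move=> rn; have [->|/pou_ord_max_far xn] := eqVneq (@pou R d n ord_max x) 0.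
  by rewrite mulr0 tail_ge0.
rewrite tail_eq_weight; last by rewrite (le_trans rn)// ltW.
by rewrite (@le_trans _ _ (npow p x)) ?lerDr// ler_piMr ?npow_ge0 ?pou_le1.
Qed.

Lemma exists_coupling_cost_le n (r : R) nu mu : 0 < p -> r + 1 <= n%:R ->
  Pp p nu -> Pp p mu ->
  exists2 pi, coupling nu mu pi & (cost p pi <=
    ((2 * n.+1%:R^-1) `^ p + 2 * 2 `^ p * (mint nu (tail p r) + mint mu (tail p r)) +
     2 * node_bound n *
       \sum_(i < (net_size n).+1) `|mint nu (pou i) - mint mu (pou i)|)%:E)%E.
Proof.
move=> p_gt0 rn nup mup; have p0 := ltW p_gt0.
have mpou (i : 'I_(net_size n).+1) : measurable_fun setT (pou i).
  exact: measurable_testfun (testfun_pou p i).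
pose pi0 := overlap_plan mpou (@pou_ge0 R d n) (@sum_pou R d n) nu mu.
have marginals := overlap_plan_marginals mpou (@pou_ge0 R d n) (@sum_pou R d n) nu mu.
have pi01 : pi0 setT = 1%E.
  by have [+ _] := marginals _ measurableT; rewrite setXTT probability_setT.
pose pi : probability (Rd * Rd)%type R := mnormalize pi0 (nu \x mu)%E.
have piE : pi = pi0 :> (set _ -> \bar R) by exact: mnormalize_eq.
exists pi; first by move=> A mA; rewrite piE; exact: marginals.
pose far x := 2 `^ p * npow p x * @pou R d n ord_max x.
have tfar : testfun p far.
  exact: testfunM_bcont (testfunZ _ (testfun_npow d p0)) (bcont_pou ord_max).
have farE (m : P) : Pp p m -> (\int[m]_x (far x)%:E = (mint m far)%:E)%E.
  by move=> mp; rewrite (mintE p0).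
have far_le (m : P) : Pp p m -> mint m far <= 2 `^ p * mint m (tail p r).
  move=> mp; rewrite -(mintZ p0 mp)//; last exact: testfun_tail.
  apply: (mint_le p0 mp tfar) => [|x]; first exact/testfunZ/testfun_tail.
  by rewrite /far -mulrA ler_wpM2l ?powR_ge0// npow_pou_ord_max_le.
have costE : cost p pi = (\int[pi0]_z (dist z.1 z.2 `^ p)%:E)%E.
  by apply: eq_measure_integral => A _ _; rewrite /= mnormalize_eq.
rewrite costE; apply: le_trans (overlap_plan_cost_le mpou (@pou_ge0 R d n) (@sum_pou R d n)
  (l := ord_max) (u := fun x => 2 `^ p * npow p x) (delta := (2 * n.+1%:R^-1) `^ p)
  (Q := node_bound n) _ _ _ _ _ _ _ _ (farE _ nup) (farE _ mup)) _.
- exact: measurable_testfun (testfunZ _ (testfun_npow d p0)).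
- by move=> x; rewrite mulr_ge0 ?powR_ge0.
- exact: measurable_powR_dist.
- by move=> z; rewrite powR_ge0 powR_dist_le.
- exact: powR_ge0.
- by move=> i z; exact: dist_same_cell_le.
- exact: node_bound_ge0.
- by move=> i x; exact: npow_le_node_bound.
rewrite lee_fin lerD2r lerD2l -mulrA ler_wpM2l// mulrDr lerD//; exact: far_le.
Qed.

Lemma diameter_powR_cvg0 : 0 < p -> (2 * n.+1%:R^-1) `^ p @[n --> \oo] --> (0 : R).
Proof.
move=> p_gt0; have twice_cvg : 2 * n.+1%:R^-1 @[n --> \oo] --> (2 * 0 : R).
  by apply: cvgM; [exact: cvg_cst|exact: cvg_harmonic].
have := cvg_comp _ _ twice_cvg (@continuous_norm_powR R p p_gt0 _).
rewrite mulr0 normr0 powR0 ?gt_eqF//; apply: cvg_trans.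
by apply: near_eq_cvg; apply: nearW => n /=; rewrite ger0_norm.
Qed.

Lemma near_Wp_lt mu (e : R) : 0 < p -> Pp p mu -> 0 < e ->
  \forall nu \near tnbhs p mu, Wp p nu mu < e.
Proof.
move=> p_gt0 mup e0; have p0 := ltW p_gt0.
set c := e `^ p; have c0 : 0 < c by rewrite powR_gt0.
have c40 : 0 < c / 4 by rewrite divr_gt0.
have q0 : 0 < 4 * 2 `^ p :> R by rewrite mulr_gt0 ?powR_gt0.
have [r near_tail] := near_mint_tail_lt p0 mup (divr_gt0 c40 q0).
have mu_tail := tnbhs_singleton mup near_tail.
have [n [rn diameter_small]] : exists n : nat,
    r%:R + 1 <= n%:R :> R /\ (2 * n.+1%:R^-1) `^ p < c / 4.
  have /cvgr_lt/(_ _ c40) small := diameter_powR_cvg0 p_gt0.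
  have [n [rn nc]] := filter_ex (filterI (nbhs_infty_ge r.+1) small).
  by exists n; split => //; rewrite natr1 ler_nat.
pose dev nu := \sum_(i < (net_size n).+1) `|mint nu (pou i) - mint mu (pou i)|.
have dev_small : \forall nu \near tnbhs p mu, 2 * node_bound n * dev nu < c / 4.
  have : 2 * node_bound n * dev nu @[nu --> tnbhs p mu] -->
      2 * node_bound n * \sum_(i < (net_size n).+1) `|mint mu (pou i) - mint mu (pou i)|.
    apply: cvgM; first exact: cvg_cst.
    apply: cvg_sum => i; apply: cvg_norm; apply: cvgB; last exact: cvg_cst.
    exact: mint_tnbhs_cvg (testfun_pou p i).
  rewrite big1 ?mulr0 => [/cvgr_lt/(_ _ c40)//|i _]; by rewrite subrr normr0.
near=> nu; have nup : Pp p nu by near: nu; exact: near_tnbhs_Pp.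
have [pi cpi pi_cost] := exists_coupling_cost_le p_gt0 rn nup mup.
apply/(Wp_ltP p_gt0 nup mup e0); exists pi => //.
apply: le_lt_trans pi_cost _; rewrite lte_fin -/c.
have nu_tail : mint nu (tail p r%:R) < c / 4 / (4 * 2 `^ p) by near: nu.
have nu_dev : 2 * node_bound n * dev nu < c / 4 by near: nu.
have : 2 * 2 `^ p * (mint nu (tail p r%:R) + mint mu (tail p r%:R)) < c / 4.
  rewrite mulrC -ltr_pdivlMr ?mulr_gt0 ?powR_gt0//.
  have -> : c / 4 / (2 * 2 `^ p) = 2 * (c / 4 / (4 * 2 `^ p)).
    by field; rewrite gt_eqF// powR_gt0.
  by rewrite mulr_natl mulr2n ltrD.
by rewrite -/(dev nu); lra.
Unshelve. all: by end_near. Qed.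

Lemma bcont_testfun0P phi : bcont phi <-> testfun 0 phi.
Proof.
split=> [|[cphi [C phiC]]]; first exact: bcont_testfun.
split; first exact/cont_RdP.
by exists (C * 2) => x; have := phiC x; rewrite /weight /npow powRr0.
Qed.

Lemma PnbhdP mu (N : set P) : 0 <= p -> Pp p mu -> Pnbhd p mu N <-> tnbhs p mu N.
Proof.
move=> p0 mup; rewrite /Pnbhd; case: ifPn => [/eqP p_eq0|p_neq0].
  rewrite p_eq0; split=> -[k [phi [e [tphi e0 phiN]]]]; exists k, phi, e;
    by split => // i; exact/bcont_testfun0P.
have p_gt0 : 0 < p by rewrite lt_def p_neq0.
split=> [[e e0 eN]|[k [phi [e [tphi e0 phiN]]]]].
  near=> nu; apply: eN; first by near: nu; exact: near_tnbhs_Pp.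
  by near: nu; exact: near_Wp_lt.
have /choice[del delP] i : exists del : R, 0 < del /\
    forall nu, Pp p nu -> Wp p nu mu < del -> `|mint nu (phi i) - mint mu (phi i)| < e.
  by have [del ? ?] := Wp_mint_close p_gt0 mup (tphi i) e0; exists del.
exists (\big[Num.min/1]_i del i).
  by elim/big_ind : _ => [//|a b a0 b0|i _]; [rewrite lt_min a0|exact: (delP i).1].
move=> nu nup W_lt; apply: phiN => // i; apply: (delP i).2 => //.
by apply: (lt_le_trans W_lt); exact: bigmin_le_cond.
Unshelve. all: by end_near. Qed.

Lemma near_covering_Pcompact (K : set P) (I : Type) (F : set_system I) {FF : Filter F}
    (Q : I -> P -> Prop) : 0 <= p -> Pcompact p K ->
  (forall mu, K mu -> \forall nu \near tnbhs p mu & i \near F, Q i nu) ->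
  \forall i \near F, K `<=` Q i.
Proof.
move=> p0 [Kp Kcover] Q_near.
pose U (A : {A : set I | F A}) : set P :=
  Pp p `&` [set mu | tnbhs p mu [set nu | forall i, sval A i -> Q i nu]].
have Uopen A : Popen p (U A).
  split=> [mu []//|mu [mup muA]]; apply/(PnbhdP _ p0 mup).
  by apply: filterI; [exact: near_tnbhs_Pp|exact: tnbhs_interior].
have [|s Ks] := Kcover _ U Uopen.
  move=> mu Kmu; have [[N A] /= [muN FA] NA] := Q_near _ Kmu.
  exists (exist _ A FA) => //; split; first exact: Kp.
  by apply: filterS muN => nu Nnu i Ai; exact: (NA (nu, i)).
suff : \forall i \near F, \big[setU/set0]_(A <- s) U A `<=` Q i.
  by apply: filterS => i sQ mu /Ks /sQ.
elim: s {Ks} => [|A s ih]; first by rewrite big_nil; near=> i.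
near=> i; rewrite big_cons => mu [[mup muA]|smu].
  by apply: (tnbhs_singleton mup muA); near: i; exact: (svalP A).
by move: mu smu; near: i; exact: ih.
Unshelve. all: by end_near. Qed.

End wasserstein_neighbourhoods.

Section sequential.
Variables (R : realType) (d : nat) (p : R).
Hypothesis p0 : 0 <= p.
Local Notation Rd := (Rd R d).
Local Notation P := (probability Rd R).
Implicit Types (mu : P) (nu : nat -> P).

Lemma Pcompact_cvg_seq mu nu : Pp p mu -> (forall j, Pp p (nu j)) ->
  nu @ \oo --> tnbhs p mu -> Pcompact p (mu |` range nu).
Proof.
move=> mup nup nu_mu; split=> [m [->//|[j _ <-]]|I U Uopen cover]; first exact: nup.
have [i0 _ Ui0] := cover mu (or_introl erefl).
have /choice[idx idxP] j : exists i, U i (nu j).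
  have [|i _ Ui] := cover (nu j); last by exists i.
  by right; exists j.
have [j0 _ nu_U] := nu_mu _ (iffLR (PnbhdP _ p0 mup) ((Uopen i0).2 _ Ui0)).
exists (i0 :: [seq idx j | j <- iota 0 j0]).
move=> _ [->|[j _ <-]]; rewrite big_cons; first by left.
have [jj0|j0j] := ltnP j j0; last by left; exact: nu_U.
by right; rewrite big_map -bigcup_seq; exists j; rewrite //= mem_iota.
Qed.

(* [tnbhs p mu] has a countable base, so what fails near [mu] fails along a
   sequence. *)
Lemma near_tnbhs_contra mu (A : nat -> set P) : Pp p mu ->
  (forall j, ~ tnbhs p mu (A j)) -> exists nu,
    [/\ forall j, Pp p (nu j), nu @ \oo --> tnbhs p mu & forall j, ~ A j (nu j)].
Proof.
move=> mup nA; have /choice[nu nuP] j : exists m, cell_nbhs p mu j m /\ ~ A j m.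
  apply: contrapT => none; apply: (nA j).
  apply: filterS (near_cell_nbhs p0 mu j) => m m_cell.
  by apply: contrapT => nAm; apply: none; exists m.
exists nu; split=> [j||j]; [exact: (nuP j).1.1| |exact: (nuP j).2].
by apply: (cell_nbhs_cvg p0 mup) => j; exact: (nuP j).1.
Qed.

End sequential.

(** * The simplex *)

Section simplex_topology.
Variables (R : realType) (k : nat).
Implicit Types (y z : 'rV[R]_k) (t : R).

Lemma simplex_itv y i : simplex y -> 0 <= y 0 i <= 1.
Proof.
move=> [y0 y1]; rewrite y0/= -y1 (bigD1 i)//= lerDl sumr_ge0// => j _; exact: y0.
Qed.

Lemma simplex_segment y z t : simplex y -> simplex z -> 0 <= t <= 1 ->
  simplex (t *: z + (1 - t) *: y).
Proof.
move=> [y0 y1] [z0 z1] /andP[t0 t1]; split.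
  by move=> i; rewrite !mxE addr_ge0 ?mulr_ge0 ?subr_ge0.
under eq_bigr do rewrite !mxE.
by rewrite big_split/= -!mulr_sumr y1 z1 !mulr1 addrC subrK.
Qed.

Lemma simplex_sum_norm_le y z : simplex y -> simplex z ->
  \sum_i `|z 0 i - y 0 i| <= 2.
Proof.
move=> [y0 y1] [z0 z1]; apply: (@le_trans _ _ (\sum_i (z 0 i + y 0 i))).
  apply: ler_sum => i _.
  by rewrite (le_trans (ler_normB _ _))// (ger0_norm (y0 i)) (ger0_norm (z0 i)).
by rewrite big_split/= y1 z1.
Qed.

Lemma compact_simplex : compact (simplex : set 'rV[R]_k).
Proof.
have /= ccube := rV_compact (fun _ : 'I_k => @segment_compact R 0 1).
have csum : continuous (fun y : 'rV[R]_k => \sum_i y 0 i : R).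
  by move=> y; apply: (@cvg_sum _ _ _ (nbhs y)) => i; exact: coord_continuous.
have csum1 : closed ((fun y : 'rV[R]_k => \sum_i y 0 i : R) @^-1` [set 1]).
  by apply: closed_comp => [y _|]; [exact: csum|exact: closed_eq].
have -> : simplex = [set y : 'rV[R]_k | forall i, `[0, 1]%classic (y ord0 i)] `&`
    ((fun y : 'rV[R]_k => \sum_i y 0 i : R) @^-1` [set 1]).
  apply/seteqP; split=> y /=.
    by move=> sy; split=> [i|]; [rewrite /= in_itv/= simplex_itv|exact: sy.2].
  by move=> [y01 y1]; split => // i; have /= := y01 i; rewrite in_itv/= => /andP[].
exact: compact_closedI.
Qed.

End simplex_topology.

(** * C^1 approximation on the simplex *)

Lemma sum_delta (R : pzSemiRingType) (I : finType) (f : I -> R) i :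
  \sum_j (i == j)%:R * f j = f i.
Proof.
rewrite (bigD1 i)//= eqxx mul1r big1 ?addr0// => j; rewrite eq_sym => /negbTE ->.
by rewrite mul0r.
Qed.

Section bernstein.
Variables (R : realType) (k : nat).
Local Notation V := 'rV[R]_k.+1.
Local Notation e_ i := (delta_mx 0 i : V).
Implicit Types (c y z : V) (F G H : V -> R).

(* [bern N F c y] is the expectation of [F] after [N] independent steps
   [e_ j] with law [y], started at [c]; for [y] off the simplex it is the
   same polynomial in [y]. *)
Fixpoint bern (N : nat) F c y : R :=
  if N is N'.+1 then \sum_j y 0 j * bern N' F (c + e_ j) y else F c.

Lemma eq_bern N F G c y : F =1 G -> bern N F c y = bern N G c y.
Proof. by move=> FG; elim: N c => [|N ih] c //=; apply: eq_bigr => j _; rewrite ih. Qed.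

Lemma bernD N F G c y : bern N (fun c => F c + G c) c y = bern N F c y + bern N G c y.
Proof.
elim: N c => [//|N ih] c /=; rewrite -big_split/=; apply: eq_bigr => j _.
by rewrite ih mulrDr.
Qed.

Lemma bernZ N a F c y : bern N (fun c => a * F c) c y = a * bern N F c y.
Proof.
elim: N c => [//|N ih] c /=; rewrite mulr_sumr; apply: eq_bigr => j _.
by rewrite ih mulrCA.
Qed.

Lemma bern_sum N (I : Type) (r : seq I) (F : I -> V -> R) c y :
  bern N (fun c => \sum_(i <- r) F i c) c y = \sum_(i <- r) bern N (F i) c y.
Proof.
elim: r => [|i r ih].
  rewrite big_nil (@eq_bern _ _ (fun=> 0 * 0)); last by move=> c'; rewrite big_nil mul0r.
  by rewrite (bernZ N 0 (fun=> 0)) mul0r.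
rewrite big_cons -ih -bernD; apply: eq_bern => c'; exact: big_cons.
Qed.

Lemma bern_shift N F c b y : bern N F (c + b) y = bern N (fun c => F (c + b)) c y.
Proof. by elim: N c => [//|N ih] c /=; apply: eq_bigr => j _; rewrite addrAC ih. Qed.

Lemma bern_cst N a c y : simplex y -> bern N (fun=> a) c y = a.
Proof.
move=> [_ y1]; elim: N c => [//|N ih] c /=.
by under eq_bigr do rewrite ih; rewrite -mulr_suml y1 mul1r.
Qed.

Lemma scaled_simplexD_delta (s : R) c j :
  scaled_simplex s c -> scaled_simplex (s + 1) (c + e_ j).
Proof.
move=> [c0 cs]; split=> [i|]; first by rewrite !mxE addr_ge0.
under eq_bigr do rewrite mxE; rewrite big_split/= cs; congr (_ + _).
rewrite -[RHS](sum_delta (fun=> 1) j); apply: eq_bigr => i _.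
by rewrite mxE eqxx mulr1 eq_sym.
Qed.

Lemma scaled_simplex0 : scaled_simplex 0 (0 : V).
Proof. by split=> [i|]; [rewrite mxE|rewrite big1// => i _; rewrite mxE]. Qed.

Lemma bern_dist_le_bern N F H a c y (s : R) : simplex y -> scaled_simplex s c ->
  (forall c', scaled_simplex (s + N%:R) c' -> `|F c' - a| <= H c') ->
  `|bern N F c y - a| <= bern N H c y.
Proof.
move=> [y0 y1]; elim: N c s => [|N ih] c s sc FH /=; first by apply: FH; rewrite addr0.
have -> : \sum_j y 0 j * bern N F (c + e_ j) y - a =
    \sum_j y 0 j * (bern N F (c + e_ j) y - a).
  by under [RHS]eq_bigr do rewrite mulrBr; rewrite sumrB -mulr_suml y1 mul1r.
rewrite (le_trans (ler_norm_sum _ _ _))//; apply: ler_sum => j _.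
rewrite normrM (ger0_norm (y0 j)) ler_wpM2l//.
apply: (ih _ _ (scaled_simplexD_delta j sc)) => c'.
by rewrite -addrA nat1r; exact: FH.
Qed.

Lemma bern_sqr_dev N i (b : R) c y : simplex y ->
  bern N (fun c' => (c' 0 i - b) ^+ 2) c y =
  (c 0 i + N%:R * y 0 i - b) ^+ 2 + N%:R * (y 0 i * (1 - y 0 i)).
Proof.
move=> [_ y1]; elim: N c => [|N ih] c /=; first by rewrite !mul0r !addr0.
pose X := c 0 i + N%:R * y 0 i - b.
under eq_bigr => j _.
  rewrite ih (_ : _ * _ = y 0 j * (X ^+ 2 + N%:R * (y 0 i * (1 - y 0 i))) +
    (i == j)%:R * y 0 j * (2 * X + 1)); last first.
    by rewrite !mxE eqxx/= /X; case: (i == j) => /=; ring.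
  over.
by rewrite big_split/= -!mulr_suml y1 mul1r sum_delta /X -natr1; ring.
Qed.

Lemma bern_sumsq_le N (b : R) y : simplex y ->
  bern N (fun c => \sum_j (c 0 j - b * y 0 j) ^+ 2) 0 y <= (N%:R - b) ^+ 2 + N%:R.
Proof.
move=> sy; rewrite bern_sum.
have -> : (N%:R - b) ^+ 2 + N%:R = \sum_j ((N%:R - b) ^+ 2 + N%:R) * y 0 j.
  by rewrite -mulr_sumr sy.2 mulr1.
apply: ler_sum => j _.
rewrite bern_sqr_dev// mxE add0r -mulrBl exprMn.
have /andP[yj0 yj1] := simplex_itv j sy.
rewrite [leRHS]mulrDl lerD// ler_wpM2l ?sqr_ge0//; first by rewrite expr2 ler_piMr.
by rewrite ler_piMr// gerBl.
Qed.

(* Chebyshev: the far grid points contribute at most [A] times the probability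
   of a deviation larger than [del]. *)
Lemma bern_chebyshev N (b del e A a : R) F y : simplex y ->
  0 < b -> (N%:R - b) ^+ 2 + N%:R <= b -> 0 < del -> 0 <= e -> 0 <= A ->
  (forall c, scaled_simplex N%:R c -> `|F c - a| <= A) ->
  (forall c, scaled_simplex N%:R c ->
     (forall j, `|b^-1 * c 0 j - y 0 j| < del) -> `|F c - a| <= e) ->
  `|bern N F 0 y - a| <= e + A / del ^+ 2 * b^-1.
Proof.
move=> sy b0 Nb del0 e0 A0 crude close.
have bdel0 : 0 < (b * del) ^+ 2 by rewrite exprn_gt0// mulr_gt0.
have Abdel0 : 0 <= A / (b * del) ^+ 2 by rewrite divr_ge0// ltW.
have sumsq0 c : 0 <= \sum_j (c 0 j - b * y 0 j) ^+ 2.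
  by apply: sumr_ge0 => j _; exact: sqr_ge0.
apply: (@le_trans _ _ (bern N (fun c => e + A / (b * del) ^+ 2 *
    \sum_j (c 0 j - b * y 0 j) ^+ 2) 0 y)); last first.
  have -> : A / del ^+ 2 * b^-1 = A / (b * del) ^+ 2 * b by field; rewrite !gt_eqF.
  rewrite bernD bern_cst// bernZ lerD2l ler_wpM2l//.
  by rewrite (le_trans (bern_sumsq_le _ _ sy)).
apply: (bern_dist_le_bern sy scaled_simplex0) => c; rewrite add0r => sc.
have [c_close|/existsNP[j /negP]] := pselect (forall j, `|b^-1 * c 0 j - y 0 j| < del).
  by rewrite (le_trans (close c sc c_close))// lerDl mulr_ge0.
rewrite -leNgt => far; rewrite (le_trans (crude c sc))// -[leLHS]add0r lerD//.
rewrite -mulrA ler_peMr// mulrC ler_pdivlMr// mul1r.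
rewrite (bigD1 j)//= (@le_trans _ _ ((c 0 j - b * y 0 j) ^+ 2))//; last first.
  by rewrite lerDl sumr_ge0// => l _; exact: sqr_ge0.
have -> : c 0 j - b * y 0 j = b * (b^-1 * c 0 j - y 0 j).
  by rewrite mulrBr mulVKf ?gt_eqF.
rewrite !exprMn ler_pM2l ?exprn_gt0// -[leRHS]real_normK ?num_real//.
by rewrite ler_sqr ?nnegrE// ltW.
Qed.

Lemma is_derive_coord y i j :
  is_derive y (e_ i) (fun y : V => y 0 j : R) (i == j)%:R.
Proof.
have quotient : (fun t : R => t^-1 *: (((fun y : V => y 0 j) \o shift y) (t *: e_ i) - y 0 j))
    @ (0 : R)^' --> ((i == j)%:R : R).
  apply: cvg_near_cst; near=> t; rewrite /= !mxE eqxx/= addrK.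
  rewrite [LHS]mulrA mulVf ?mul1r; first by rewrite eq_sym.
  by near: t; exact: nbhs_dnbhs_neq.
by apply: DeriveDef; [apply/cvg_ex; exists (i == j)%:R|exact: cvg_lim].
Unshelve. all: by end_near. Qed.

Lemma is_derive_bern N F c y i :
  is_derive y (e_ i) (bern N F c) (N%:R * bern N.-1 F (c + e_ i) y).
Proof.
elim: N c => [|N ih] c; first by rewrite mul0r; exact: is_derive_cst.
have -> : bern N.+1 F c = \sum_j ((fun y : V => y 0 j : R) * (bern N F (c + e_ j)) : V -> R).
  by apply/funext => z; rewrite fct_sumE.
apply: is_derive_eq.
  by apply: is_derive_sum => j; exact: (is_deriveM (is_derive_coord y i j) (ih _)).
rewrite big_split/=.
under [X in _ + X]eq_bigr do rewrite [_ *: _]mulrC.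
rewrite sum_delta -[in RHS]natr1 mulrDl mul1r; congr (_ + _).
case: N ih => [|N] ih; first by rewrite mul0r big1// => j _; rewrite mul0r scaler0.
rewrite /= mulr_sumr; apply: eq_bigr => j _.
by rewrite [LHS]mulrCA addrAC.
Qed.

Lemma continuous_bern N F c : continuous (bern N F c).
Proof.
elim: N c => [|N ih] c y; first exact: cst_continuous.
apply: (@cvg_sum _ _ _ (nbhs y)) => j; apply: continuousM; [exact: coord_continuous|exact: ih].
Qed.

End bernstein.

Section simplex_approximation.
Variables (R : realType) (k : nat).
Local Notation V := 'rV[R]_k.+1.
Local Notation e_ i := (delta_mx 0 i : V).
Implicit Types (c y z : V).

(* [G] is a gradient of [h] only up to an additive constant: the weights
   [z 0 i - y 0 i] sum to 0. *)
Definition simplex_mean_value (h : V -> R) (G : 'I_k.+1 -> V -> R) : Prop :=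
  forall y z, simplex y -> simplex z -> forall a D : R,
    (forall t, 0 <= t <= 1 ->
      `|\sum_i (z 0 i - y 0 i) * G i (t *: z + (1 - t) *: y) - a| <= D) ->
    `|h z - h y - a| <= D.

Variables (h : V -> R) (G : 'I_k.+1 -> V -> R).

Definition grid_point (n : nat) c : V := n.+1%:R^-1 *: c.

Definition forward_difference n i c : R :=
  n.+1%:R * (h (grid_point n (c + e_ i)) - h (grid_point n (c + e_ 0))).

Definition bern_correction n c : R :=
  G 0 (grid_point n (c + e_ 0)) - n.+1%:R * h (grid_point n (c + e_ 0)).

(* The second term vanishes on the simplex; it fixes the additive constant of
   the gradient, which the values on the simplex do not determine. *)
Definition bern_C1 n y : R :=
  bern n.+1 (h \o grid_point n) 0 y + (\sum_j y 0 j - 1) * bern n (bern_correction n) 0 y.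

Definition bern_C1_derive n i y : R :=
  n.+1%:R * bern n (h \o grid_point n) (0 + e_ i) y +
  ((\sum_j y 0 j - 1) * (n%:R * bern n.-1 (bern_correction n) (0 + e_ i) y) +
   bern n (bern_correction n) 0 y).

Lemma is_derive_bern_C1 n i y : is_derive y (e_ i) (bern_C1 n) (bern_C1_derive n i y).
Proof.
pose s : V -> R := (\sum_j (fun y : V => y 0 j : R)) - cst (1 : R).
have sE z : s z = \sum_j z 0 j - 1 by rewrite /s !fctE/= fct_sumE.
have ds : is_derive y (e_ i) s (1 : R).
  apply: is_derive_eq; first apply: is_deriveB.
    by apply: is_derive_sum => j; exact: is_derive_coord.
  by rewrite subr0; under eq_bigr do rewrite -[_%:R]mulr1; exact: sum_delta (fun=> 1) i.
have -> : bern_C1 n = bern n.+1 (h \o grid_point n) 0 + s * bern n (bern_correction n) 0.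
  by apply/funext => z; rewrite /bern_C1 -sE.
apply: is_derive_eq.
  apply: is_deriveD; first exact: is_derive_bern.
  exact: (is_deriveM ds (is_derive_bern _ _ _ _ _)).
by rewrite /bern_C1_derive sE /GRing.scale/= mulr1.
Qed.

Lemma pderiv_bern_C1 n i : pderiv (bern_C1 n) i = bern_C1_derive n i.
Proof. by apply/funext => y; have [_] := is_derive_bern_C1 n i y. Qed.

Lemma C1Rn_bern_C1 n : C1Rn (bern_C1 n).
Proof.
move=> i; split=> [y|]; first by have [] := is_derive_bern_C1 n i y.
have cscale (a : R) N F c : continuous (fun y => a * bern N F c y).
  by move=> y; apply: continuousM; [exact: cst_continuous|exact: continuous_bern].
rewrite pderiv_bern_C1 /bern_C1_derive => y.
apply: (continuousD (x := y)); first exact: cscale.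
apply: (continuousD (x := y)); last exact: continuous_bern.
apply: (@continuousM _ _ _ _ y); last exact: cscale.
apply: (continuousB (x := y)); last exact: cst_continuous.
by apply: (@cvg_sum _ _ _ (nbhs y)) => j; exact: coord_continuous.
Qed.

Lemma bern_C1_simplex n y : simplex y -> bern_C1 n y = bern n.+1 (h \o grid_point n) 0 y.
Proof. by move=> [_ y1]; rewrite /bern_C1 y1 subrr mul0r addr0. Qed.

Lemma pderiv_bern_C1_simplex n i y : simplex y -> pderiv (bern_C1 n) i y =
  bern n (fun c => forward_difference n i c + G 0 (grid_point n (c + e_ 0))) 0 y.
Proof.
move=> [_ y1]; rewrite pderiv_bern_C1 /bern_C1_derive bern_shift y1 subrr mul0r add0r.
rewrite -bernZ -bernD; apply: eq_bern => c.
by rewrite /forward_difference /bern_correction /=; ring.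
Qed.

Lemma simplex_grid_point n c : scaled_simplex n.+1%:R c -> simplex (grid_point n c).
Proof.
move=> [c0 cn]; split=> [i|]; first by rewrite mxE mulr_ge0.
by under eq_bigr do rewrite mxE; rewrite -mulr_sumr cn mulVf.
Qed.

Lemma simplex_grid_pointD n c i : scaled_simplex n%:R c ->
  simplex (grid_point n (c + e_ i)).
Proof.
by move=> cn; apply: simplex_grid_point; rewrite -natr1; exact: scaled_simplexD_delta.
Qed.

Hypothesis mean_value : simplex_mean_value h G.
Variable M : R.
Hypothesis G_le : forall i y, simplex y -> `|G i y| <= M.

Let M0 : 0 <= M.
Proof.
apply: le_trans (G_le 0 (_ : simplex (0 + e_ 0))); first exact: normr_ge0.
by rewrite -[1]add0r; apply: scaled_simplexD_delta; exact: scaled_simplex0.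
Qed.

Lemma simplex_lipschitz y z : simplex y -> simplex z ->
  `|h z - h y| <= M * \sum_i `|z 0 i - y 0 i|.
Proof.
move=> sy sz; rewrite -[X in `|X|]subr0; apply: (mean_value sy sz) => t t01.
rewrite subr0 mulr_sumr (le_trans (ler_norm_sum _ _ _))//; apply: ler_sum => i _.
by rewrite normrM mulrC ler_wpM2r// G_le//; exact: simplex_segment.
Qed.

Definition grid_segment n i c (t : R) : V :=
  t *: grid_point n (c + e_ i) + (1 - t) *: grid_point n (c + e_ 0).

Lemma simplex_grid_segment n i c t : scaled_simplex n%:R c -> 0 <= t <= 1 ->
  simplex (grid_segment n i c t).
Proof. by move=> cn; apply: simplex_segment; exact: simplex_grid_pointD. Qed.

Lemma grid_segment_dist_le n i c t j : 0 <= t <= 1 ->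
  `|grid_segment n i c t 0 j - n.+1%:R^-1 * c 0 j| <= n.+1%:R^-1.
Proof.
move=> /andP[t0 t1]; rewrite !mxE eqxx/=.
have -> : forall a b : R, t * (n.+1%:R^-1 * (c 0 j + a)) +
    (1 - t) * (n.+1%:R^-1 * (c 0 j + b)) - n.+1%:R^-1 * c 0 j =
    n.+1%:R^-1 * (t * a + (1 - t) * b) by move=> a b; ring.
rewrite normrM gtr0_norm ?invr_gt0// ler_piMr ?invr_ge0// ger0_norm.
  by case: (j == i); case: (j == 0); rewrite ?mulr0 ?mulr1; lra.
by rewrite addr_ge0// mulr_ge0// subr_ge0.
Qed.

Lemma forward_difference_dist_le n i c (a D : R) : scaled_simplex n%:R c ->
  (forall t, 0 <= t <= 1 ->
    `|G i (grid_segment n i c t) - G 0 (grid_segment n i c t) - a| <= D) ->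
  `|forward_difference n i c - a| <= D.
Proof.
move=> cn segment_le; have N0 : 0 < n.+1%:R :> R by [].
have -> : forward_difference n i c - a = n.+1%:R *
    (h (grid_point n (c + e_ i)) - h (grid_point n (c + e_ 0)) - n.+1%:R^-1 * a).
  by rewrite [RHS]mulrBr mulVKf ?gt_eqF.
rewrite normrM gtr0_norm// -ler_pdivlMl//.
apply: (mean_value (simplex_grid_pointD 0 cn) (simplex_grid_pointD i cn)) => t t01.
rewrite -/(grid_segment n i c t).
under eq_bigr => l _.
  rewrite (_ : _ * _ = n.+1%:R^-1 * ((i == l)%:R * G l (grid_segment n i c t) -
    (0 == l)%:R * G l (grid_segment n i c t))); last first.
    by rewrite !mxE eqxx/= ![_ == l]eq_sym; ring.
  over.
rewrite -mulr_sumr sumrB !(sum_delta (G ^~ _)) -mulrBr normrM gtr0_norm ?invr_gt0//.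
by rewrite ler_pM2l ?invr_gt0// segment_le.
Qed.

Lemma gradient_dist_le_crude n i c y : scaled_simplex n%:R c -> simplex y ->
  `|forward_difference n i c + G 0 (grid_point n (c + e_ 0)) - G i y| <= 4 * M.
Proof.
move=> cn sy.
have difference_le : `|forward_difference n i c - 0| <= 2 * M.
  apply: forward_difference_dist_le => // t t01; rewrite subr0 (le_trans (ler_normB _ _))//.
  by rewrite mulr_natl mulr2n lerD// G_le//; exact: simplex_grid_segment.
have := G_le 0 (simplex_grid_pointD 0 cn); have := G_le i sy; move: difference_le.
rewrite subr0 !ler_norml => /andP[d1 d2] /andP[a1 a2] /andP[b1 b2].
by apply/andP; split; lra.
Qed.

Lemma gradient_dist_le n i c y (e del : R) : scaled_simplex n%:R c -> simplex y ->
  (forall l z, simplex z -> (forall j, `|z 0 j - y 0 j| < del) -> `|G l z - G l y| <= e) ->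
  (forall j, `|n.+1%:R^-1 * c 0 j - y 0 j| < del / 2) -> n.+1%:R^-1 < del / 2 ->
  `|forward_difference n i c + G 0 (grid_point n (c + e_ 0)) - G i y| <= 3 * e.
Proof.
move=> cn sy G_near c_near n_large.
have seg_near l t : 0 <= t <= 1 -> `|G l (grid_segment n i c t) - G l y| <= e.
  move=> t01; apply: G_near => [|j]; first exact: simplex_grid_segment.
  rewrite [del]splitr (le_lt_trans (ler_distD (n.+1%:R^-1 * c 0 j) _ _))// ltrD//.
  by rewrite (le_lt_trans (grid_segment_dist_le _ _ _ _ t01)).
have difference_le : `|forward_difference n i c - (G i y - G 0 y)| <= 2 * e.
  apply: forward_difference_dist_le => // t t01.
  have := seg_near i t t01; have := seg_near 0 t t01.
  by rewrite !ler_norml => /andP[a1 a2] /andP[b1 b2]; apply/andP; split; lra.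
have := seg_near 0 0; rewrite lexx ler01 /grid_segment scale0r add0r subr0 scale1r.
move=> /(_ isT) vertex_le; move: difference_le vertex_le.
by rewrite !ler_norml => /andP[a1 a2] /andP[b1 b2]; apply/andP; split; lra.
Qed.

Lemma bern_C1_dist_le n y (del : R) : simplex y -> 0 < del ->
  `|bern_C1 n y - h y| <= M * (k.+1%:R * del) + M * 2 / del ^+ 2 * n.+1%:R^-1.
Proof.
move=> sy del0; rewrite bern_C1_simplex//.
apply: bern_chebyshev => //; rewrite ?subrr ?expr0n ?add0r ?mulr_ge0 ?(ltW del0)// => c cn.
  rewrite (le_trans (simplex_lipschitz sy (simplex_grid_point cn)))// ler_wpM2l//.
  by rewrite simplex_sum_norm_le//; exact: simplex_grid_point.
move=> c_near; rewrite (le_trans (simplex_lipschitz sy (simplex_grid_point cn)))//.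
rewrite ler_wpM2l// mulr_natl -[k.+1 in leRHS]card_ord -sumr_const ler_sum// => j _.
by rewrite mxE ltW.
Qed.

Lemma pderiv_bern_C1_dist_le n i y (e del : R) : simplex y -> 0 <= e -> 0 < del ->
  (forall l z, simplex z -> (forall j, `|z 0 j - y 0 j| < del) -> `|G l z - G l y| <= e) ->
  n.+1%:R^-1 < del / 2 ->
  `|pderiv (bern_C1 n) i y - G i y| <= 3 * e + 4 * M / (del / 2) ^+ 2 * n.+1%:R^-1.
Proof.
move=> sy e0 del0 G_near n_large; rewrite pderiv_bern_C1_simplex//.
apply: bern_chebyshev => //; rewrite ?mulr_ge0 ?divr_gt0//.
- by rewrite -natr1 opprD addrA subrr add0r sqrrN expr1n addrC.
- by move=> c cn; exact: gradient_dist_le_crude.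
- by move=> c cn c_near; exact: (gradient_dist_le i cn sy G_near).
Qed.

End simplex_approximation.

Section simplex_C1_approximation.
Variables (R : realType) (k : nat).
Local Notation V := 'rV[R]_k.+1.
Implicit Types (y z : V) (G : 'I_k.+1 -> V -> R).

Lemma simplex_bounded G : (forall i, {within simplex, continuous (G i)}) ->
  exists M, forall i y, simplex y -> `|G i y| <= M.
Proof.
move=> cG.
have bounded i : \forall M \near +oo, forall y, simplex y -> `|G i y| <= M.
  have [M [_ GM]] := compact_bounded (continuous_compact (cG i) (@compact_simplex R k.+1)).
  by exists M; split=> [|N MN y sy]; [exact: num_real|apply: (GM N MN); exists y].
have [M GM] := filter_ex (filter_forall _ bounded).
by exists M => i y; exact: GM.
Qed.

Lemma simplex_unif_continuous G (e : R) :
  (forall i, {within simplex, continuous (G i)}) -> 0 < e ->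
  \forall del \near 0^'+, forall i y z, simplex y -> simplex z ->
    (forall j, `|z 0 j - y 0 j| < del) -> `|G i z - G i y| <= e.
Proof.
move=> cG e0.
have unif i : \forall del \near 0^'+, forall y z, simplex y -> simplex z ->
    (forall j, `|z 0 j - y 0 j| < del) -> `|G i z - G i y| <= e.
  near=> del => y z sy sz yz; rewrite distrC ltW//.
  have : forall y z : V, simplex y -> simplex z -> ball y del z -> ball (G i y) e (G i z).
    by near: del; exact: (compact_unif_continuous (@compact_simplex R k.+1) (cG i)).
  by apply=> //; split=> // l j; rewrite ord1 /ball/= distrC.
exact: (filter_forall _ unif).
Unshelve. all: by end_near. Qed.

Lemma simplex_C1_approx (h : V -> R) G (e : R) : simplex_mean_value h G ->
  (forall i, {within simplex, continuous (G i)}) -> 0 < e ->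
  exists g, C1Rn g /\ forall y, simplex y ->
    `|g y - h y| <= e /\ forall i, `|pderiv g i y - G i y| <= e.
Proof.
move=> mean_value cG e0; have [M GM] := simplex_bounded cG.
have e6 : 0 < e / 6 by rewrite divr_gt0.
have e2 : 0 < e / 2 by rewrite divr_gt0.
near (0 : R)^'+ => del; near \oo => n.
have del0 : 0 < del by near: del; exact: nbhs_right_gt.
have G_unif i y z : simplex y -> simplex z -> (forall j, `|z 0 j - y 0 j| < del) ->
    `|G i z - G i y| <= e / 6.
  by move: i y z; near: del; exact: simplex_unif_continuous.
have del_small : M * k.+1%:R * del < e / 2.
  near: del; apply: (cvgr_lt 0) => //; rewrite -[0 in X in _ --> X](mulr0 (M * k.+1%:R)).
  by apply: cvgM; [exact: cvg_cst|exact: cvg_at_right_filter cvg_id].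
have h_small : M * 2 / del ^+ 2 * n.+1%:R^-1 < e / 2.
  by near: n; exact: near_mulr_invn_lt.
have G_small : 4 * M / (del / 2) ^+ 2 * n.+1%:R^-1 < e / 2.
  by near: n; exact: near_mulr_invn_lt.
have n_large : n.+1%:R^-1 < del / 2 by near: n; apply: near_invn_lt; rewrite divr_gt0.
exists (bern_C1 h G n); split=> [|y sy]; first exact: C1Rn_bern_C1.
split=> [|i].
  rewrite (le_trans (bern_C1_dist_le mean_value GM n sy del0))//.
  by rewrite [leRHS]splitr mulrA lerD// ltW.
have := pderiv_bern_C1_dist_le mean_value GM i sy (ltW e6) del0
  (fun l z sz => G_unif l y z sy sz) n_large.
move=> /le_trans; apply; rewrite [leRHS]splitr lerD ?(ltW G_small)//; lra.
Unshelve. all: by end_near. Qed.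

End simplex_C1_approximation.

(** * Functions of class C^1 on P_p *)

Section differentiable.
Variables (R : realType) (d : nat) (p : R).
Hypothesis p0 : 0 <= p.
Local Notation Rd := (Rd R d).
Local Notation P := (probability Rd R).
Implicit Types (x y : Rd) (mu nu : P).
Variables (f : P -> R) (Df : Rd -> P -> R).
Hypothesis fC1 : C1P p f Df.

Lemma Df_cvg x mu : Pp p mu ->
  Df z.1 z.2 @[z --> filter_prod (nbhs x) (tnbhs p mu)] --> Df x mu.
Proof.
move=> mup; apply/cvgrPdist_lt => e e0; have [Df_cont _ _] := fC1.
have [del del0 [N [muN near_xmu]]] := Df_cont x mu mup e e0.
exists ([set y | dist y x < del], Pp p `&` N) => /=.
  split; first by apply/nbhs_RdP; exists del.
  by apply: filterI; [exact: near_tnbhs_Pp|exact/(PnbhdP _ p0 mup)].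
by move=> [y nu] [/= yx [nup Nnu]]; rewrite distrC near_xmu.
Qed.

Lemma Df_tnbhs_cvg x mu : Pp p mu -> Df x nu @[nu --> tnbhs p mu] --> Df x mu.
Proof.
move=> mup A /(Df_cvg (x := x) mup)[[U N] /= [xU muN] UN].
by apply: filterS muN => nu Nnu; apply: (UN (x, nu)); split => //; exact: nbhs_singleton.
Qed.

Lemma continuous_Df mu : Pp p mu -> continuous (Df ^~ mu).
Proof.
move=> mup x A /(Df_cvg (x := x) mup)[[U N] /= [xU muN] UN].
apply: filterS xU => y Uy; apply: (UN (y, mu)); split => //.
exact: tnbhs_singleton mup muN.
Qed.

Lemma Df_locally_bounded mu : Pp p mu ->
  exists c, \forall nu \near tnbhs p mu, forall x, `|Df x nu| <= c * weight p x.
Proof.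
move=> mup; have [_ Df_bounded _] := fC1; apply: contrapT => unbounded.
have [j|nu [nup nu_mu nu_large]] := near_tnbhs_contra p0
    (A := fun j => [set nu | forall x, `|Df x nu| <= j%:R * weight p x]) mup.
  by move=> muA; apply: unbounded; exists j%:R.
have [c Df_le] := Df_bounded _ (Pcompact_cvg_seq p0 mup nup nu_mu).
near \oo => j; apply: (nu_large j) => x.
rewrite (le_trans (Df_le x (nu j) _))//; first by right; exists j.
by rewrite ler_wpM2r ?weight_ge0//; near: j; exact: nbhs_infty_ger.
Unshelve. all: by end_near. Qed.

Lemma testfun_Df mu : Pp p mu -> testfun p (Df ^~ mu).
Proof.
move=> mup; split; first exact: continuous_Df.
by have [c Df_le] := Df_locally_bounded mup; exists c; exact: tnbhs_singleton mup Df_le.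
Qed.

(* Measures are functions on all subsets, so two distinct ones may agree on
   the Borel sets. *)
Lemma Df_ext x mu nu : Pp p mu -> Pp p nu ->
  (forall phi, testfun p phi -> mint nu phi = mint mu phi) -> Df x nu = Df x mu.
Proof.
move=> mup nup mint_eq; apply/eqP; rewrite -subr_eq0 -normr_le0.
apply/ler_addgt0Pr => e e0; rewrite add0r.
have /cvgrPdist_le/(_ _ e0)[k [phi [del [tphi del0]]]] := Df_tnbhs_cvg (x := x) mup.
move=> /(_ nu nup); rewrite distrC; apply => i.
by rewrite mint_eq// subrr normr0.
Qed.

Lemma C1P_mean_value mu nu (a D : R) : Pp p mu -> Pp p nu ->
  (forall t, 0 <= t <= 1 -> `|mint nu (Df ^~ (pmix t nu mu)) -
     mint mu (Df ^~ (pmix t nu mu)) - a| <= D) -> `|f nu - f mu - a| <= D.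
Proof.
have [_ _ f_integral] := fC1; move=> mup nup.
exact: unit_integral_dist_le (f_integral _ _ mup nup).
Qed.

Lemma dominated_cvg_Df mu : Pp p mu ->
  dominated_cvg p (tnbhs p mu) (fun nu => Df ^~ nu) (Df ^~ mu).
Proof.
move=> mup; split=> [e r e0|].
  have /compact_near_coveringP ball_covering := @compact_enorm_le R d r.
  apply: (ball_covering P _ (fun nu x => `|Df x nu - Df x mu| <= e)) => x _.
  have e20 : 0 < e / 2 by rewrite divr_gt0.
  have /cvgrPdist_lt/(_ _ e20) joint := Df_cvg (x := x) mup.
  have /cvgrPdist_lt/(_ _ e20) at_mu : Df y mu @[y --> x] --> Df x mu by exact: continuous_Df.
  near=> z; rewrite (le_trans (ler_distD (Df x mu) _ _))// [leRHS]splitr lerD// ltW//.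
    by rewrite distrC; near: z; exact: joint.
  by near: z; exact: cvg_fst at_mu.
have [c Df_le] := Df_locally_bounded mup; exists (c + c).
have mu_le := tnbhs_singleton mup Df_le; apply: filterS Df_le => nu nu_le x.
by rewrite (le_trans (ler_normB _ _))// mulrDl lerD.
Unshelve. all: by end_near. Qed.

Lemma C1P_cvg mu : Pp p mu -> f nu @[nu --> tnbhs p mu] --> f mu.
Proof.
move=> mup; have tDf : \forall nu \near tnbhs p mu, testfun p (Df ^~ nu).
  by apply: filterS (near_tnbhs_Pp p mu); exact: testfun_Df.
have /cvgrPdist_le mint_cvg : mint z.1 (Df ^~ z.2) @[z --> filter_prod (tnbhs p mu) (tnbhs p mu)]
    --> mint mu (Df ^~ mu).
  by apply: dominated_cvg_mint tDf (dominated_cvg_Df mup) => //; exact: testfun_Df.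
apply/cvgrPdist_le => e e0; have e20 : 0 < e / 2 by rewrite divr_gt0.
have [[A B] /= [muA muB] AB] := mint_cvg _ e20.
have near_mix := pmix_tnbhs p0 mup muB.
near=> nu; rewrite distrC -[X in `|X|]subr0.
have nup : Pp p nu by near: nu; exact: near_tnbhs_Pp.
apply: (C1P_mean_value mup nup) => t t01; rewrite subr0.
have Bmix : B (pmix t nu mu) by move: t t01; near: nu.
have Anu : A nu by near: nu.
have Amu : A mu := tnbhs_singleton mup muA.
rewrite (le_trans (ler_distD (mint mu (Df ^~ mu)) _ _))// [leRHS]splitr lerD//.
  by rewrite distrC; exact: (AB (nu, pmix t nu mu)).
exact: (AB (mu, pmix t nu mu)).
Unshelve. all: by end_near. Qed.

Definition C1_bound (c : R) nu := `|f nu| <= c /\ forall x, `|Df x nu| <= c * weight p x.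

Lemma near_C1_bound mu : Pp p mu ->
  \forall nu \near tnbhs p mu & c \near +oo, C1_bound c nu.
Proof.
move=> mup; have [c Df_le] := Df_locally_bounded mup.
have f_near : \forall nu \near tnbhs p mu, `|f nu| <= `|f mu| + 1.
  by apply: cvgr_norm_le (C1P_cvg mup) _ _; rewrite ltrDl.
exists ([set nu | `|f nu| <= `|f mu| + 1 /\ forall x, `|Df x nu| <= c * weight p x],
  [set b | `|f mu| + 1 <= b /\ c <= b]) => /=.
  by split; [exact: filterI|apply: filterI; apply: nbhs_pinfty_ge; exact: num_real].
move=> [nu b] [/= [f_le nu_le] [fb cb]]; split=> [|x]; first exact: le_trans fb.
by rewrite (le_trans (nu_le x))// ler_wpM2r ?weight_ge0.
Qed.

End differentiable.

Section C1P_on_simplex.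
Variables (R : realType) (d : nat) (p : R).
Hypothesis p0 : 0 <= p.
Local Notation Rd := (Rd R d).
Local Notation P := (probability Rd R).
Variables (k : nat) (x : 'I_k.+1 -> Rd).
Implicit Types y z : 'rV[R]_k.+1.

Lemma discrete_measure_cvg y : simplex y ->
  discrete_measure x z @[z --> within simplex (nbhs y)] --> tnbhs p (discrete_measure x y).
Proof.
move=> sy; apply/cvg_tnbhsP; split.
  by rewrite near_withinE; apply: nearW => z /(mint_discrete_measure p0 x)[].
move=> phi tphi; have [_ ->//] := mint_discrete_measure p0 x sy.
apply: (@cvg_trans _ ((fun z => \sum_i z 0 i * phi (x i)) @ within simplex (nbhs y))).
  apply: near_eq_cvg; rewrite near_withinE; apply: nearW => z sz.
  by have [_ ->] := mint_discrete_measure p0 x sz.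
apply: cvg_within_filter; apply: (@cvg_sum _ _ _ (nbhs y)) => i.
by apply: continuousM; [exact: coord_continuous|exact: cst_continuous].
Qed.

Lemma within_simplex_continuous (h : P -> R) :
  (forall mu, Pp p mu -> h nu @[nu --> tnbhs p mu] --> h mu) ->
  {within simplex, continuous (h \o discrete_measure x)}.
Proof.
move=> h_cvg; apply/subspace_continuousP => y sy.
have [yp _] := mint_discrete_measure p0 x sy.
exact: cvg_comp (discrete_measure_cvg sy) (h_cvg _ yp).
Qed.

Variables (f : P -> R) (Df : Rd -> P -> R).
Hypothesis fC1 : C1P p f Df.

Lemma simplex_mean_value_C1P :
  simplex_mean_value (f \o discrete_measure x) (fun i => Df (x i) \o discrete_measure x).
Proof.
move=> y z sy sz a D close.
have [yp yE] := mint_discrete_measure p0 x sy; have [zp zE] := mint_discrete_measure p0 x sz.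
apply: (C1P_mean_value fC1 yp zp) => t t01.
have [mixp mixE] := mint_pmix p0 t01 yp zp.
have sw := simplex_segment sy sz t01; have [wp wE] := mint_discrete_measure p0 x sw.
have DfE u : Df u (pmix t (discrete_measure x z) (discrete_measure x y)) =
    Df u (discrete_measure x (t *: z + (1 - t) *: y)).
  apply: (Df_ext p0 fC1) => // phi tphi; rewrite mixE// wE// zE// yE// !mulr_sumr -big_split/=.
  by apply: eq_bigr => i _; rewrite !mxE; ring.
rewrite zE ?yE; try exact: (testfun_Df p0 fC1).
rewrite -sumrB; have := close t t01; congr (`|_ - _| <= _).
by apply: eq_bigr => i _; rewrite DfE mulrBl.
Qed.

Lemma near_simplex_C1_bound :
  \forall c \near +oo, forall y, simplex y -> C1_bound p f Df c (discrete_measure x y).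
Proof.
have /compact_near_coveringP/near_covering_withinP simplex_covering := @compact_simplex R k.+1.
apply: (simplex_covering R _ (fun c y => C1_bound p f Df c (discrete_measure x y))) => y sy.
have [yp _] := mint_discrete_measure p0 x sy.
have [[N A] /= [yN cA] NA] := near_C1_bound p0 fC1 yp.
exists ([set z | simplex z -> N (discrete_measure x z)], A) => /=.
  by split => //; exact: (discrete_measure_cvg sy yN).
by move=> [z c] [/= Nz Ac] sz; apply: (NA (discrete_measure x z, c)); split => //; exact: Nz.
Qed.

End C1P_on_simplex.

Lemma cvg_invn_close (R : realType) (u v : nat -> R) (l : R) :
  (forall n, `|u n - v n| <= n.+1%:R^-1) -> v @ \oo --> l -> u @ \oo --> l.
Proof.
move=> uv vl; apply: cvg_sub0 vl; apply: norm_cvg0.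
apply: (@squeeze_cvgr _ _ _ _ (cst 0) (fun n => n.+1%:R^-1)).
- by apply: nearW => n; rewrite normr_ge0 uv.
- exact: cvg_cst.
- exact: cvg_harmonic.
Qed.

Section cylinder_approximation.
Variables (R : realType) (d : nat) (p : R).
Hypothesis p0 : 0 <= p.
Local Notation Rd := (Rd R d).
Local Notation P := (probability Rd R).
Local Notation V n := 'rV[R]_(@net_size R d n).+1.
Implicit Types (x : Rd) (mu nu : P) (K : set P).
Variables (f : P -> R) (Df : Rd -> P -> R).
Hypothesis fC1 : C1P p f Df.

(* [interp n (Df ^~ (discretization n mu))] is the derivative at [mu] of
   [f \o discretization n]. *)
Definition cylinder_close n (e : R) (g : V n -> R) := forall mu, Pp p mu ->
  `|cyl g pou mu - f (discretization n mu)| <= e /\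
  forall x, `|cylD g pou x mu - interp n (Df ^~ (discretization n mu)) x| <= e.

Lemma cylinder_close_exists n (e : R) : 0 < e ->
  exists g : V n -> R, C1Rn g /\ cylinder_close e g.
Proof.
move=> e0.
have Df_continuous (i : 'I_(net_size n).+1) :
    {within simplex, continuous (Df (node i) \o discrete_measure (@node R d n))}.
  by apply: (within_simplex_continuous p0) => mu; exact: (Df_tnbhs_cvg p0 fC1).
have [g [gC1 g_close]] :=
  simplex_C1_approx (simplex_mean_value_C1P p0 fC1) Df_continuous e0.
exists g; split => // mu mup.
have [f_close Df_close] := g_close _ (simplex_cell_masses p0 n mup).
split=> [//|x]; have -> : cylD g pou x mu - interp n (Df ^~ (discretization n mu)) x =
    \sum_i pou i x * (pderiv g i (cell_masses n mu) - Df (node i) (discretization n mu)) - 0.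
  by rewrite subr0 /cylD /interp -sumrB; apply: eq_bigr => i _; rewrite mulrBr [X in X - _]mulrC.
by apply: pou_mean_dist_le => i _; rewrite subr0; exact: Df_close.
Qed.

Lemma discretization_C1_bound K : Pcompact p K ->
  \forall c \near +oo, forall n mu, K mu -> C1_bound p f Df c (discretization n mu).
Proof.
move=> Kc.
have large_n : \forall nc \near filter_prod \oo +oo, K `<=` [set mu |
    C1_bound p f Df nc.2 (discretization nc.1 mu)].
  apply: (near_covering_Pcompact (p := p)) => // mu /Kc.1 mup.
  have [[A C] /= [muA ooC] AC] := near_C1_bound p0 fC1 mup.
  have [[B N] /= [muB ooN] BN] := discretization_cvg p0 mup muA.
  exists (B, N `*` C) => /=; first by split => //; exists (N, C).
  move=> [nu [n c]] [/= Bnu [Nn Cc]]; apply: (AC (discretization n nu, c)).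
  by split => //; exact: (BN (nu, n)).
have [[N C] /= [[n0 _ Nn0] ooC] NC] := large_n.
have small_n : \forall c \near +oo, forall (n : 'I_n0) mu, K mu ->
    C1_bound p f Df c (discretization n mu).
  apply: filter_forall => n; apply: filterS (near_simplex_C1_bound p0 node fC1) => c bound.
  by move=> mu /Kc.1 mup; apply: bound; exact: (simplex_cell_masses p0).
apply: filterS2 small_n ooC => c small_c Cc n mu Kmu; have [n0n|nn0] := leqP n0 n.
  by apply: (NC (n, c)) => //; split => //; exact: Nn0.
exact: (small_c (Ordinal nn0)).
Qed.

Variable g : forall n, V n -> R.
Hypothesis g_close : forall n, cylinder_close n.+1%:R^-1 (@g n).

Lemma cyl_cvg mu : Pp p mu -> cyl (@g n) pou mu @[n --> \oo] --> f mu.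
Proof.
move=> mup; apply: (cvg_invn_close (v := fun n => f (discretization n mu))).
  by move=> n; have [] := g_close n mup.
exact: cvg_comp (discretization_cvg_at p0 mup) (C1P_cvg p0 fC1 mup).
Qed.

Lemma cylD_cvg x mu : Pp p mu -> cylD (@g n) pou x mu @[n --> \oo] --> Df x mu.
Proof.
move=> mup; apply: (cvg_invn_close (v := fun n => interp n (Df ^~ (discretization n mu)) x)).
  by move=> n; have [_] := g_close n mup; exact.
apply: (interp_cvg (phi_ := fun n => Df ^~ (discretization n mu))) => A.
move=> /(Df_cvg p0 fC1 mup)[[U N] /= [xU muN] UN].
exists ([set n | N (discretization n mu)], U) => /=.
  by split => //; exact: (discretization_cvg_at p0 mup).
by move=> [n y] [/= Nn Uy]; exact: (UN (y, discretization n mu)).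
Qed.

Lemma cylinder_bounded K : Pcompact p K -> exists c : R, forall n x mu, K mu ->
  `|cyl (@g n) pou mu| <= c /\ `|cylD (@g n) pou x mu| <= c * (1 + npow p x).
Proof.
move=> Kc; near +oo_R => c.
have bound n mu : K mu -> C1_bound p f Df c (discretization n mu).
  by move: n mu; near: c; exact: discretization_C1_bound.
have c0 : 0 <= c by near: c; apply: nbhs_pinfty_ge; exact: num_real.
have cq0 : 0 <= c * (2 * 2 `^ p) by rewrite !mulr_ge0.
exists (1 + (c + c * (2 * 2 `^ p))) => n x mu Kmu.
have [f_le Df_le] := bound n mu Kmu; have [f_close Df_close] := g_close n (Kc.1 _ Kmu).
have inv_le1 : n.+1%:R^-1 <= 1 :> R by rewrite invf_le1// ler1n.
split.
  rewrite -[cyl _ _ _](subrK (f (discretization n mu))) (le_trans (ler_normD _ _))// lerD//.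
    exact: le_trans inv_le1.
  by rewrite (le_trans f_le)// lerDl.
rewrite -[cylD _ _ _ _](subrK (interp n (Df ^~ (discretization n mu)) x)).
rewrite (le_trans (ler_normD _ _))// mulrDl lerD//.
  by rewrite mul1r (le_trans (Df_close x))// (le_trans inv_le1)// weight_ge1.
by rewrite (le_trans (interp_growth p0 _ _ Df_le))// ler_wpM2r ?weight_ge0// lerDr.
Unshelve. all: by end_near. Qed.

End cylinder_approximation.

Theorem theorem4p4 (R : realType) (d : nat) (p : R) (hp : p = 0 \/ 1 <= p)
  (f : probability (Rd R d) R -> R) (Df : Rd R d -> probability (Rd R d) R -> R) :
  C1P p f Df ->
  exists (k : nat -> nat) (g : forall n, 'rV[R]_(k n) -> R)
         (phi : forall n, 'I_(k n) -> Rd R d -> R),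
    [/\ forall n, C1Rn (g n),
        forall n i, bcont (phi n i),
        forall mu, Pp p mu -> cyl (g n) (phi n) mu @[n --> \oo] --> f mu,
        forall (x : Rd R d) mu, Pp p mu ->
          cylD (g n) (phi n) x mu @[n --> \oo] --> Df x mu &
        forall K, Pcompact p K -> exists c : R, forall n (x : Rd R d) mu, K mu ->
          `|cyl (g n) (phi n) mu| <= c /\
          `|cylD (g n) (phi n) x mu| <= c * (1 + npow p x)].
Proof.
move=> fC1; have p0 : 0 <= p by case: hp => [->//|]; exact: le_trans.
have g_ex n : {g : 'rV[R]_(@net_size R d n).+1 -> R | C1Rn g /\ cylinder_close p f Df n.+1%:R^-1 g}.
  by apply: cid; exact: cylinder_close_exists.
pose g n := sval (g_ex n).
have g_close n : cylinder_close p f Df n.+1%:R^-1 (g n) := (svalP (g_ex n)).2.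
exists (fun n => (net_size n).+1), g, (fun n => @pou R d n); split.
- by move=> n; exact: (svalP (g_ex n)).1.
- by move=> n i; exact: bcont_pou.
- exact: (cyl_cvg p0 fC1 g_close).
- exact: (cylD_cvg p0 fC1 g_close).
- exact: (cylinder_bounded p0 fC1 g_close).
Qed.
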